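(* Let $k\geq2$ and let $G=K_{n_1,\ldots,n_k}$ be a complete multipartite graph with $2\leq n_1\leq\cdots\leq n_k$. Then $\operatorname{depth}_S(S/J_G)=n_1+2$.
   Context: $\mathbb{K}$ is an arbitrary field and all graphs are finite and simple. For a graph $G$, put $S=\mathbb{K}[x_u,y_u : u\in V(G)]$; the binomial edge ideal $J_G\subset S$ is generated by the binomials $x_uy_w-x_wy_u$ with $\{u,w\}\in E(G)$. $K_{n_1,\ldots,n_k}$ is the graph whose vertex set is partitioned into $k$ parts of sizes $n_1,\dots,n_k$, two vertices being adjacent if and only if they lie in different parts. Depth is with respect to the graded maximal ideal. *)

(* Defs.v *)
From HB Require Import structures.
From mathcomp Require Import all_boot all_algebra generic_quotient ring_quotient.
From mathcomp Require Import mpoly.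
From mathcomp Require Import boolp.

Set Implicit Arguments.
Unset Strict Implicit.
Unset Printing Implicit Defensive.

Import GRing.Theory.
Local Open Scope ring_scope.
Local Open Scope quotient_scope.

Record submodule (R : comNzRingType) (M : lmodType R) := Submodule {
  submod_pred :> {pred M};
  submod_pred_closed : submod_closed submod_pred
}.

HB.instance Definition _ (R : comNzRingType) (M : lmodType R)
    (N : submodule M) :=
  GRing.isSubmodClosed.Build R M (submod_pred N) (submod_pred_closed N).

Section QuotientModule.
Variables (R : comNzRingType) (M : lmodType R) (N : submodule M).

Definition quot_mod : Type := Quotient.quot (submod_pred N).
HB.instance Definition _ := GRing.Zmodule.on quot_mod.

Definition quot_scale (a : R) (x : quot_mod) : quot_mod :=
  \pi_(Quotient.quot (submod_pred N)) (a *: repr (x : Quotient.quot (submod_pred N))).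

Lemma quot_scale_pi (a : R) (x : M) :
  quot_scale a (\pi_(Quotient.quot (submod_pred N)) x) = \pi_(Quotient.quot (submod_pred N)) (a *: x).
Proof.
apply/eqP; rewrite -Quotient.idealrBE -scalerBr rpredZ //.
by rewrite Quotient.idealrBE reprK.
Qed.

Fact quot_scalerA a b x :
  quot_scale a (quot_scale b x) = quot_scale (a * b) x.
Proof. by rewrite {2}/quot_scale quot_scale_pi scalerA. Qed.

Fact quot_scale1r : left_id 1 quot_scale.
Proof. by move=> x; rewrite /quot_scale scale1r reprK. Qed.

Fact quot_scalerDr : right_distributive quot_scale +%R.
Proof.
move=> a x y; rewrite -[x](@reprK _ (Quotient.quot (submod_pred N))).
rewrite -[y](@reprK _ (Quotient.quot (submod_pred N))) -[_ + _](raddfD \pi_(Quotient.quot (submod_pred N))).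
by rewrite !quot_scale_pi scalerDr raddfD.
Qed.

Fact quot_scalerDl x : {morph quot_scale^~ x : a b / a + b}.
Proof. by move=> a b; rewrite /quot_scale scalerDl raddfD. Qed.

HB.instance Definition _ := GRing.Zmodule_isLmodule.Build R quot_mod
  quot_scalerA quot_scale1r quot_scalerDr quot_scalerDl.
End QuotientModule.

Section GeneratedIdeal.
Variables (R : comNzRingType) (E : R -> Prop).

(* Ideals of [R] are the submodules of the regular module [R^o]. *)
Definition ideal_gen_pred : {pred R^o} := fun f =>
  `[< exists s : seq (R * R),
        (forall p, p \in s -> E p.2) /\ f = \sum_(p <- s) p.1 * p.2 >].

Fact ideal_gen_submod_closed : submod_closed ideal_gen_pred.
Proof.
split; first by apply/asboolP; exists [::]; rewrite big_nil.
move=> a f g /asboolP[s [Es ->]] /asboolP[t [Et ->]].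
apply/asboolP; exists ([seq (a * p.1, p.2) | p <- s] ++ t); split.
  by move=> p; rewrite mem_cat => /orP[/mapP[q /Es Eq ->]|/Et].
rewrite big_cat big_map scaler_sumr; congr (_ + _).
by apply: eq_bigr => p _; rewrite -mulrA.
Qed.

Definition ideal_gen : submodule R^o := Submodule ideal_gen_submod_closed.
End GeneratedIdeal.

Section Depth.
Variables (R : comNzRingType) (M : lmodType R).

(* x belongs to (s_0, ..., s_(r-1)) M *)
Definition in_seq_mul (s : seq R) (x : M) : Prop :=
  exists m : 'I_(size s) -> M, x = \sum_(i < size s) s`_i *: m i.

(* s_i is a nonzerodivisor on M / (s_0, ..., s_(i-1)) M for every i,
   and M / s M is nonzero. *)
Definition regular_seq (s : seq R) : Prop :=
  (forall i : nat, (i < size s)%N -> forall x : M,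
     in_seq_mul (take i s) (s`_i *: x) -> in_seq_mul (take i s) x) /\
  (exists x : M, ~ in_seq_mul s x).

(* The depth of M with respect to I: the supremum of the lengths of the
   M-regular sequences in I. *)
Definition has_depth (I : {pred R}) (d : nat) : Prop :=
  (exists s : seq R, [/\ {subset s <= I}, regular_seq s & size s = d]) /\
  (forall s : seq R, {subset s <= I} -> regular_seq s -> (size s <= d)%N).
End Depth.

(* The variables x_u (u in V) come first, then the variables y_u. *)
Notation bei_ring K V := {mpoly K[#|V| + #|V|]}.

Section BinomialEdgeIdeal.
Variables (K : fieldType) (V : finType).

Definition xvar (u : V) : bei_ring K V := 'X_(lshift #|V| (enum_rank u)).
Definition yvar (u : V) : bei_ring K V := 'X_(rshift #|V| (enum_rank u)).

Definition binomial_edge_ideal (e : rel V) : submodule (bei_ring K V)^o :=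
  ideal_gen (fun f : bei_ring K V => exists u w : V,
    e u w /\ f = xvar u * yvar w - xvar w * yvar u).

Definition graded_max_ideal : submodule (bei_ring K V)^o :=
  ideal_gen (fun f : bei_ring K V => exists u : V, f = xvar u \/ f = yvar u).
End BinomialEdgeIdeal.

(* [e] is the adjacency relation of K_(n_0, ..., n_(k-1)); the parts are the
   fibres of [part]. *)
Definition complete_multipartite (k : nat) (n : 'I_k -> nat)
    (V : finType) (e : rel V) : Prop :=
  exists part : V -> 'I_k,
    (forall i, #|[set v | part v == i]| = n i) /\
    (forall u w, e u w = (part u != part w)).

(* Main.v *)
From HB Require Import structures.
Require Import Defs.
From mathcomp Require Import all_boot all_algebra generic_quotient ring_quotient.
From mathcomp Require Import mpoly boolp ring zify.

(** Let V_1, ..., V_k be the parts, P the ideal of all maximal minors of the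
    generic matrix with columns (x_u, y_u), and Q_i the ideal generated by the
    variables outside of V_i.  Turning the parts one at a time from cliques into
    independent sets leads from P to J_G, and the Pluecker relations show that
    each step intersects the current ideal J with Q_i, while J + Q_i = P + Q_i:
      0 -> S/(J /\ Q_i) -> S/J + S/Q_i -> S/(P + Q_i) -> 0.
    So it suffices to find a sequence of n_1 + 2 linear forms which is regular
    on S/P and on all S/Q_i and whose first n_1 + 1 members are regular on all
    S/(P + Q_i).  A Hankel specialisation of the matrix whose columns are sums of
    one column from each part, with two further forms, works over any field.
    Conversely, S/(P + Q_1) modulo those n_1 + 1 forms has a nonzero socle
    element, hence nonzero Koszul cohomology in degree 0, and the long exact
    sequences lift it to degree n_1 + 2 for S/J_G, which bounds the length of
    all regular sequences. *)

Set Implicit Arguments.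
Unset Strict Implicit.
Unset Printing Implicit Defensive.

Import GRing.Theory.
Local Open Scope ring_scope.
Local Open Scope quotient_scope.

(** * Weakly regular sequences on quotients by ideals *)

Section Ideals.
Variable R : comNzRingType.
Implicit Types (I J N : R -> Prop) (f g x y z : R) (s : seq R).

(** The constant is $(n_1+1)+1$: the ring $S/(P+Q_i)$ of rank one $2\times n_i$ matrices has
    dimension $n_i+1$, the smallest part is the worst, and the kernel of a surjection onto such a
    ring can carry one more regular form. A single sequence must serve all the quotients at once,
    and a finite field may have too few elements for general linear forms; so the forms are
    explicit, and each regularity is certified by vectors on which some forms vanish and another
    does not. That $S/P$, $S/Q_i$ and $S/(P+Q_i)$ are domains settles only the first form. After
    cutting a determinantal ring by $x(a)$, multiplication by $y(a)$ splits it into a polynomial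
    ring, where all $x$ vanish, and a determinantal ring with one column less; regularity is
    propagated through this splitting. The upper bound concerns every regular sequence, not only
    extensions of the one constructed, hence the use of an invariant that does not depend on the
    sequence: the Koszul cohomology on all variables. *)

Record idealp I : Prop := Idealp {
  ideal0 : I 0;
  idealD : forall f g, I f -> I g -> I (f + g);
  idealM : forall a f, I f -> I (a * f) }.

Lemma idealN I f : idealp I -> I f -> I (- f).
Proof. by move=> iI If; rewrite -mulN1r; apply: idealM. Qed.

Lemma idealB I f g : idealp I -> I f -> I g -> I (f - g).
Proof. by move=> iI If Ig; apply: idealD => //; apply: idealN. Qed.

Lemma idealBr I f g : idealp I -> I (f - g) -> I g -> I f.
Proof. by move=> iI Ifg Ig; rewrite -(subrK g f); apply: idealD. Qed.

Lemma ideal_sum I (T : Type) (r : seq T) (P : pred T) (F : T -> R) :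
  idealp I -> (forall i, P i -> I (F i)) -> I (\sum_(i <- r | P i) F i).
Proof.
move=> iI IF; elim/big_ind: _ => //; first exact: ideal0.
by move=> f g; apply: idealD.
Qed.

Lemma pred_eqP I J : (forall f, I f <-> J f) -> I = J.
Proof. by move=> IJ; apply: funext => f; apply: propext. Qed.

Definition adj I x : R -> Prop := fun f => exists a, I (f - a * x).
Definition isum I J : R -> Prop := fun f => exists2 g, I g & J (f - g).
Definition icap I J : R -> Prop := fun f => I f /\ J f.
Definition colon I g : R -> Prop := fun f => I (f * g).
Definition gideal (E : R -> Prop) : R -> Prop :=
  fun f => forall I, idealp I -> (forall g, E g -> I g) -> I f.

Lemma idealp_adj I x : idealp I -> idealp (adj I x).
Proof.
move=> iI; split.
- by exists 0; rewrite mul0r subr0; apply: ideal0.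
- move=> f g [a Ia] [b Ib]; exists (a + b).
  have -> : f + g - (a + b) * x = (f - a * x) + (g - b * x) by ring.
  exact: idealD.
- move=> c f [a Ia]; exists (c * a).
  have -> : c * f - c * a * x = c * (f - a * x) by ring.
  exact: idealM.
Qed.

Lemma idealp_isum I J : idealp I -> idealp J -> idealp (isum I J).
Proof.
move=> iI iJ; split.
- by exists 0; rewrite ?subr0; apply: ideal0.
- move=> f g [a Ia Ja] [b Ib Jb]; exists (a + b); first exact: idealD.
  have -> : f + g - (a + b) = (f - a) + (g - b) by ring.
  exact: idealD.
- move=> c f [a Ia Ja]; exists (c * a); first exact: idealM.
  by rewrite -mulrBr; apply: idealM.
Qed.

Lemma idealp_colon I g : idealp I -> idealp (colon I g).
Proof.
move=> iI; rewrite /colon; split; first by rewrite mul0r; apply: ideal0.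
- by move=> f h ? ?; rewrite mulrDl; apply: idealD.
- by move=> c f ?; rewrite -mulrA; apply: idealM.
Qed.

Lemma idealp_gideal (E : R -> Prop) : idealp (gideal E).
Proof.
split; first by move=> I iI _; apply: ideal0.
- by move=> f g Ef Eg I iI EI; apply: idealD => //; [apply: Ef|apply: Eg].
- by move=> c f Ef I iI EI; apply: idealM => //; apply: Ef.
Qed.

Lemma idealp_ker (A : comNzRingType) (h : {rmorphism R -> A}) :
  idealp (fun f => h f = 0).
Proof.
split; first exact: rmorph0.
  by move=> f g f0 g0; rewrite rmorphD f0 g0 addr0.
by move=> f g g0; rewrite rmorphM g0 mulr0.
Qed.

Lemma mem_gideal (E : R -> Prop) f : E f -> gideal E f.
Proof. by move=> Ef I _; apply. Qed.

Lemma gideal_sub (E : R -> Prop) I :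
  idealp I -> (forall g, E g -> I g) -> forall f, gideal E f -> I f.
Proof. by move=> iI EI f; apply. Qed.

Lemma sub_adj I x f : I f -> adj I x f.
Proof. by move=> If; exists 0; rewrite mul0r subr0. Qed.

Lemma mem_adj I x : idealp I -> adj I x x.
Proof. by move=> iI; exists 1; rewrite mul1r subrr; apply: ideal0. Qed.

Lemma adj_sub I J x : idealp J -> (forall f, I f -> J f) -> J x ->
  forall f, adj I x f -> J f.
Proof.
by move=> iJ IJ Jx f [a /IJ Ja]; apply: (idealBr iJ Ja); apply: idealM.
Qed.

Lemma isum_sub I J N : idealp N -> (forall f, I f -> N f) ->
  (forall f, J f -> N f) -> forall f, isum I J f -> N f.
Proof. by move=> iN IN JN f [a /IN Na /JN Nb]; apply: (idealBr iN Nb). Qed.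

Lemma sub_isuml I J f : idealp J -> I f -> isum I J f.
Proof. by move=> iJ If; exists f => //; rewrite subrr; apply: ideal0. Qed.

Lemma sub_isumr I J f : idealp I -> J f -> isum I J f.
Proof. by move=> iI Jf; exists 0; [apply: ideal0 | rewrite subr0]. Qed.

Lemma adjC I x y : idealp I -> adj (adj I x) y = adj (adj I y) x.
Proof.
move=> iI; apply: pred_eqP => f; split=> -[a [b Ib]]; exists b; exists a;
  by move: Ib; congr (I _); ring.
Qed.

Lemma adj_isum I J x : idealp J -> adj (isum I J) x = isum (adj I x) J.
Proof.
move=> iJ; apply: pred_eqP => f; split.
- move=> [a [g Ig Jg]]; exists (g + a * x); last by move: Jg; congr (J _); ring.
  by exists a; rewrite addrK.
- move=> [g [a Ig] Jg]; exists a, (g - a * x) => //.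
  by move: Jg; congr (J _); ring.
Qed.

Lemma adj_isumr I J x : idealp I -> idealp J ->
  adj (isum I J) x = isum (adj I x) (adj J x).
Proof.
move=> iI iJ; apply: pred_eqP => f; split.
- rewrite adj_isum // => -[g Ig Jg]; exists g => //; exact: sub_adj.
- have iS : idealp (adj (isum I J) x) by apply/idealp_adj/idealp_isum.
  apply: isum_sub => //; apply: adj_sub => //; try exact/mem_adj/idealp_isum.
    by move=> g Ig; apply/sub_adj/sub_isuml.
  by move=> g Jg; apply/sub_adj/sub_isumr.
Qed.

Definition regular I x : Prop := forall f, I (x * f) -> I f.

Fixpoint wreg I s : Prop :=
  if s is x :: s' then regular I x /\ wreg (adj I x) s' else True.

Definition adjs I s : R -> Prop := foldl adj I s.

Lemma idealp_adjs I s : idealp I -> idealp (adjs I s).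
Proof. by elim: s I => //= x s IHs I iI; apply/IHs/idealp_adj. Qed.

Lemma wregP I s : wreg I s <->
  forall i, (i < size s)%N -> regular (adjs I (take i s)) s`_i.
Proof.
elim: s I => [|x s IHs] I //=; split.
  by case=> rx /IHs rs [|i] //= /rs.
by move=> rs; split; [have := rs 0%N isT | apply/IHs => i /(rs i.+1)].
Qed.

Lemma regular_cap I J x : regular I x -> regular J x -> regular (icap I J) x.
Proof. by move=> rI rJ f [/rI If /rJ Jf]. Qed.

(** If [f - a * x] is in [I] and [f - b * x] in [J], then [x * (b - a)] is in [I + J], hence so is
    [b - a]. Splitting this difference corrects [a] to a coefficient that serves both ideals. *)
Lemma adj_cap I J x : idealp I -> idealp J -> regular (isum I J) x ->
  adj (icap I J) x = icap (adj I x) (adj J x).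
Proof.
move=> iI iJ rx; apply: pred_eqP => f; split.
  by case=> a [Ia Ja]; split; exists a.
case=> [[a Ia] [b Jb]].
have [|c Ic Jc] := rx (b - a).
  exists (f - a * x) => //.
  have -> : x * (b - a) - (f - a * x) = - (f - b * x) by ring.
  exact: idealN.
exists (a + c); split.
  have -> : f - (a + c) * x = (f - a * x) - x * c by ring.
  by apply: idealB => //; apply: idealM.
have -> : f - (a + c) * x = (f - b * x) + x * (b - a - c) by ring.
by apply: idealD => //; apply: idealM.
Qed.

(** The depth lemma in explicit form. While the members of [s] are adjoined, [adj_cap] keeps the
    ideal an intersection; the last form [t] only has to be regular on the two outer quotients. *)
Lemma wreg_cap I J s t : idealp I -> idealp J ->
  wreg I (rcons s t) -> wreg J (rcons s t) -> wreg (isum I J) s ->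
  wreg (icap I J) (rcons s t).
Proof.
elim: s I J => [|x s IHs] I J iI iJ /=.
  by move=> [rI _] [rJ _] _; split=> //; apply: regular_cap.
move=> [rI wI] [rJ wJ] [rS wS]; split; first exact: regular_cap.
rewrite adj_cap //; apply: IHs => //; try exact: idealp_adj.
by rewrite -adj_isumr.
Qed.

(* Exactness of 0 -> R/(I : g) -> R/I -> R/(I + (g)) -> 0. *)
Lemma wreg_colon I g s : idealp I ->
  wreg (colon I g) s -> wreg (adj I g) s -> wreg I s.
Proof.
elim: s I => [|x s IHs] I iI //= [rc wc] [ra wa].
have r1 a f : I (x * f - a * g) -> exists b, I (f - b * g).
  by move=> If; apply: ra; exists a.
split.
  move=> f If; have [|b Ib] := r1 0 f; first by rewrite mul0r subr0.
  apply: (idealBr iI Ib); apply: (rc b); rewrite /colon.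
  have -> : x * b * g = x * f - x * (f - b * g) by ring.
  by apply: idealB => //; apply: idealM.
(* Regularity of [x] modulo [I + (g)] makes the colon by [g] commute with adjoining [x]. *)
have cE : colon (adj I x) g = adj (colon I g) x.
  apply: pred_eqP => f; rewrite /colon; split; case=> a.
    move=> Ia; have [|b Ib] := r1 f a.
      by rewrite -(opprK (_ - _)); apply: idealN => //; move: Ia; congr (I _); ring.
    exists b; have -> : (f - b * x) * g = (f * g - a * x) + x * (a - b * g) by ring.
    by apply: idealD => //; apply: idealM.
  by move=> Ia; exists (a * g); move: Ia; congr (I _); ring.
apply: IHs; [exact: idealp_adj| by rewrite cE | by rewrite adjC].
Qed.

Lemma adj_congr I x y :
  idealp I -> I (x - y) -> adj I x = adj I y.
Proof.
move=> iI Ixy; apply: pred_eqP => f; split=> -[c Ic]; exists c.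
  have -> : f - c * y = (f - c * x) + c * (x - y) by ring.
  by apply: idealD => //; apply: idealM.
have -> : f - c * x = (f - c * y) - c * (x - y) by ring.
by apply: idealB => //; apply: idealM.
Qed.

Lemma mem_adjs J s x :
  idealp J -> x \in s -> adjs J s x.
Proof.
elim: s J => //= y s IHs J iJ; rewrite inE => /predU1P[->|]; last first.
  by apply: IHs; apply: idealp_adj.
have: adj J y y by apply: mem_adj.
have: idealp (adj J y) by apply: idealp_adj.
elim: s (adj J y) {IHs} => //= z s IHs J' iJ' J'y; apply: IHs; first exact: idealp_adj.
exact: sub_adj.
Qed.

Lemma sub_adjs J s x : J x -> adjs J s x.
Proof. by elim: s J => //= y s IHs J Jx; apply: IHs; apply: sub_adj. Qed.

Lemma adjs_sub J J' s : idealp J' ->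
  (forall f, J f -> J' f) -> (forall x, x \in s -> J' x) ->
  forall f, adjs J s f -> J' f.
Proof.
move=> iJ'; elim: s J => [|y s IHs] J JJ' sJ' //=; apply: IHs.
  by apply: adj_sub => //; apply: sJ'; rewrite mem_head.
by move=> x xs; apply: sJ'; rewrite inE xs orbT.
Qed.

End Ideals.

(** * Koszul cohomology *)

Section Koszul.
Variable R : comNzRingType.
Implicit Types (I J N : R -> Prop) (f g x y : R) (zs : seq R).
Implicit Types (c e w : seq bool -> R) (b : seq bool).

(** The Koszul differential. A mask [b] of length [size zs] stands for a subset of [zs]; the
    recursion presents the complex as the mapping cone of multiplication by the head. Masks of other
    lengths carry no meaning. *)
Fixpoint kosz zs c b : R :=
  match zs, b with
  | z :: zs', false :: b' => kosz zs' (fun a => c (false :: a)) b'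
  | z :: zs', true :: b' =>
      z * c (false :: b') - kosz zs' (fun a => c (true :: a)) b'
  | _, _ => 0
  end.

Lemma koszD zs c e b : kosz zs (fun a => c a + e a) b = kosz zs c b + kosz zs e b.
Proof.
elim: zs c e b => [|z zs IHs] c e [|[] b] //=; rewrite ?addr0 //.
by rewrite IHs; ring.
Qed.

Lemma koszZ zs x c b : kosz zs (fun a => x * c a) b = x * kosz zs c b.
Proof.
elim: zs c b => [|z zs IHs] c [|[] b] //=; rewrite ?mulr0 //.
by rewrite IHs; ring.
Qed.

Lemma koszB zs c e b : kosz zs (fun a => c a - e a) b = kosz zs c b - kosz zs e b.
Proof.
have -> : (fun a => c a - e a) = (fun a => c a + (-1) * e a).
  by apply: funext => a; rewrite mulN1r.
by rewrite koszD koszZ mulN1r.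
Qed.

Lemma kosz_kosz zs c b : kosz zs (kosz zs c) b = 0.
Proof.
elim: zs c b => [|z zs IHs] c [|[] b] //=; rewrite koszB koszZ IHs subr0.
by rewrite subrr.
Qed.

Lemma kosz_deg0 zs c b : count id b = 0%N -> kosz zs c b = 0.
Proof. by elim: zs c b => [|z zs IHs] c [|[] b] //= b0; apply: IHs. Qed.

Definition cochain_in n j I c : Prop :=
  forall b, size b = n -> count id b = j -> I (c b).

Lemma kosz_in zs j I c : idealp I ->
  cochain_in (size zs) j I c -> cochain_in (size zs) j.+1 I (kosz zs c).
Proof.
move=> iI; elim: zs j c => [|z zs IHs] j c cI [|[] b] //=; rewrite ?add0n ?add1n.
- case=> sb [cb]; apply: idealB => //.
    by apply: idealM => //; apply: cI; rewrite /= ?sb.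
  case: j cI cb => [|j] cI cb; first by rewrite kosz_deg0 //; exact: ideal0 iI.
  by apply: (IHs j) => // a sa ca; apply: cI; rewrite /= ?sa ?ca.
- by case=> sb cb; apply: (IHs j) => // a sa ca; apply: cI; rewrite /= ?sa.
Qed.

Lemma kosz_scaled zs I c b : idealp I ->
  (forall z a, z \in zs -> I (z * c a)) -> I (kosz zs c b).
Proof.
move=> iI; elim: zs c b => [|z zs IHs] c [|[] b] //= cI; try exact: (ideal0 iI).
  apply: idealB => //; first by apply: cI; rewrite mem_head.
  by apply: IHs => y a ys; apply: cI; rewrite inE ys orbT.
by apply: IHs => y a ys; apply: cI; rewrite inE ys orbT.
Qed.

(** The homotopy is required to be linear, in the shape in which the differential of a cone combines
    two cochains, and to respect values in every ideal [I], so that it descends to the complexes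
    over all the quotients [R / I]. *)
Definition nullhomotopic zs y : Prop :=
  exists h : (seq bool -> R) -> seq bool -> R,
    [/\ forall c b, size b = size zs -> y * c b = kosz zs (h c) b + h (kosz zs c) b,
        forall x c e b, h (fun a => x * c a - e a) b = x * h c b - h e b
      & forall I j c, idealp I -> cochain_in (size zs) j.+1 I c ->
          cochain_in (size zs) j I (h c) ].

Lemma kosz0 zs b : kosz zs (fun=> 0) b = 0.
Proof.
rewrite -[RHS](mul0r (kosz zs (fun=> 0) b)) -koszZ.
by congr (kosz _ _ _); apply: funext => ?; rewrite mul0r.
Qed.

Lemma nullhomotopic0 zs : nullhomotopic zs 0.
Proof.
exists (fun _ _ => 0); split.
- by move=> c b sb; rewrite kosz0 mul0r addr0.
- by move=> *; rewrite mulr0 subr0.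
- by move=> I j c iI _ b _ _; exact: ideal0 iI.
Qed.

Lemma nullhomotopicD zs x y :
  nullhomotopic zs x -> nullhomotopic zs y -> nullhomotopic zs (x + y).
Proof.
move=> [h [hE hL hI]] [k [kE kL kI]]; exists (fun c b => h c b + k c b); split.
- by move=> c b sb; rewrite koszD mulrDl hE // kE //; ring.
- by move=> a c e b; rewrite hL kL; ring.
- move=> I j c iI cI b sb cb; apply: idealD => //.
    by apply: hI sb cb.
  by apply: kI sb cb.
Qed.

Lemma nullhomotopicM zs a y : nullhomotopic zs y -> nullhomotopic zs (a * y).
Proof.
move=> [h [hE hL hI]]; exists (fun c b => a * h c b); split.
- by move=> c b sb; rewrite koszZ -mulrA hE //; ring.
- by move=> x c e b; rewrite hL; ring.
- by move=> I j c iI cI b sb cb; apply: idealM => //; apply: hI sb cb.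
Qed.

(** For the head of the list, contraction against it is a homotopy. A homotopy for the tail extends
    to both halves of the cone, with a sign on the half that contains the head. *)
Lemma nullhomotopic_mem zs y : y \in zs -> nullhomotopic zs y.
Proof.
elim: zs => [|z zs IHs] //; rewrite inE => /predU1P[->|/IHs {IHs}].
  exists (fun c b => if b is false :: b' then c (true :: b') else 0); split.
  - by move=> c [|[] b] //= _; rewrite ?kosz0; ring.
  - by move=> x c e [|[] b] //; ring.
  - move=> I j c iI cI [|[] b] //=; try by move=> *; exact: ideal0 iI.
    by case=> sb cb; apply: cI; rewrite /= ?sb -?cb.
case=> h [hE hL hI].
exists (fun c b => match b with
  | false :: b' => h (fun a => c (false :: a)) b'
  | true :: b' => - h (fun a => c (true :: a)) b'
  | [::] => 0 end); split.
- move=> c [|[] b] //= [sb]; last exact: (hE (fun a => c (false :: a))).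
  have {}hE := hE (fun a => c (true :: a)) b sb.
  rewrite hL hE.
  rewrite (_ : kosz zs (fun a => - h _ a) b = - kosz zs (h (fun a => c (true :: a))) b).
    ring.
  rewrite -[RHS]add0r -(kosz0 zs b) -koszB; congr (kosz _ _ _).
  by apply: funext => a; rewrite sub0r.
- by move=> x c e [|[] b] //; rewrite ?hL; ring.
- move=> I j c iI cI [|[] b] //=; try by move=> *; exact: ideal0 iI.
    case=> sb; case: j cI => // j cI [cb]; apply: idealN => //.
    by apply: (hI I j) => // a sa ca; apply: cI; rewrite /= ?sa ?ca.
  by case=> sb cb; apply: (hI I j) => // a sa ca; apply: cI; rewrite /= ?sa.
Qed.

Lemma nullhomotopic_gideal zs y : gideal (fun z => z \in zs) y -> nullhomotopic zs y.
Proof.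
apply: gideal_sub => [|z]; last exact: nullhomotopic_mem.
split; [exact: nullhomotopic0 | exact: nullhomotopicD | exact: nullhomotopicM].
Qed.

(* Vanishing of the [j]-th Koszul cohomology module of [R / I] with respect
   to [zs]; a cochain of degree [j] is a function on the subsets of [zs], of
   which only the values on the subsets of size [j] matter. *)
Definition koszul_vanish zs I j : Prop :=
  forall c, cochain_in (size zs) j.+1 I (kosz zs c) ->
    exists e, cochain_in (size zs) j I (fun b => c b - kosz zs e b).

Lemma cochain_lift n j I y c : cochain_in n j (adj I y) c ->
  exists w, cochain_in n j I (fun b => c b - y * w b).
Proof.
move=> cI; have [w wP] : {w : _ & forall b, adj I y (c b) -> I (c b - y * w b)}.
  apply: (boolp.choice (P := fun b a => adj I y (c b) -> I (c b - y * a))) => b.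
  case: (pselect (adj I y (c b))) => [[a Ia]|nI]; last by exists 0.
  by exists a; rewrite mulrC.
by exists w => b sb cb; apply/wP/cI.
Qed.

Lemma cochain_split n j I J c : cochain_in n j (isum I J) c ->
  exists2 w, cochain_in n j I w & cochain_in n j J (fun b => c b - w b).
Proof.
move=> cI; have [w wP] : {w : _ & forall b, isum I J (c b) -> I (w b) /\ J (c b - w b)}.
  apply: (boolp.choice (P := fun b a => isum I J (c b) -> I a /\ J (c b - a))) => b.
  by case: (pselect (isum I J (c b))) => [[a Ia Ja]|nI]; [exists a | exists 0].
by exists w => b sb cb; have [] := wP b (cI b sb cb).
Qed.

(** A null-homotopic [y] acts as zero on cohomology, but injectively in degree 0, where the
    cohomology lies inside [R / I]. *)
Lemma koszul_vanish0_regular zs I y : idealp I -> nullhomotopic zs y ->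
  regular I y -> koszul_vanish zs I 0.
Proof.
move=> iI [h [hE _ hI]] ry c cI; exists (fun=> 0) => b sb cb.
rewrite kosz0 subr0; apply: ry; rewrite hE // kosz_deg0 // add0r.
exact: (hI I 0%N).
Qed.

(** As [y] acts as zero on cohomology, the connecting map from degree [j] of [R / (I + (y))] to
    degree [j.+1] of [R / I] is onto; the class of [h c] is a preimage of that of [c]. *)
Lemma koszul_vanish_adj_succ zs I y j : idealp I -> nullhomotopic zs y ->
  regular I y -> koszul_vanish zs (adj I y) j -> koszul_vanish zs I j.+1.
Proof.
move=> iI [h [hE _ hI]] ry vy c cI.
have hdc := hI _ _ _ iI cI.
have [|e eI] := vy (h c).
  move=> b sb cb; exists (c b).
  have -> : kosz zs (h c) b - c b * y = - h (kosz zs c) b.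
    by rewrite mulrC hE //; ring.
  by apply: idealN => //; apply: hdc.
have [w wI] := cochain_lift eI.
have {}wI := kosz_in iI wI.
exists w => b sb cb; apply: ry.
have -> : y * (c b - kosz zs w b) =
    h (kosz zs c) b + kosz zs (fun b => h c b - kosz zs e b - y * w b) b.
  by rewrite mulrBr hE // !koszB kosz_kosz koszZ; ring.
by apply: idealD => //; [apply: hdc | apply: wI].
Qed.

(** Exactness at the middle of $H^j(R/I) \to H^j(R/(I+(y))) \to H^{j+1}(R/I)$; [w] represents the
    connecting image of [c]. *)
Lemma koszul_vanish_adj zs I y j : idealp I -> regular I y ->
  koszul_vanish zs I j -> koszul_vanish zs I j.+1 -> koszul_vanish zs (adj I y) j.
Proof.
move=> iI ry v0 v1 c cI.
have [w wI] := cochain_lift cI.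
have [|v vI] := v1 w.
  move=> b sb cb; apply: ry.
  have -> : y * kosz zs w b = - kosz zs (fun b => kosz zs c b - y * w b) b.
    by rewrite koszB koszZ kosz_kosz; ring.
  by apply: idealN => //; apply: (kosz_in iI wI).
have [|e eI] := v0 (fun b => c b - y * v b).
  move=> b sb cb.
  have -> : kosz zs (fun b => c b - y * v b) b =
      (kosz zs c b - y * w b) + y * (w b - kosz zs v b).
    by rewrite koszB koszZ; ring.
  by apply: idealD => //; [apply: wI | apply: idealM => //; apply: vI].
exists e => b sb cb; exists (v b).
by have := eI b sb cb; congr (I _); ring.
Qed.

(** Exactness at the middle of $H^j(R/I)\oplus H^j(R/J) \to H^j(R/(I+J)) \to H^{j+1}(R/(I\cap J))$;
    up to sign, [w] represents the connecting image of [c]. *)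
Lemma koszul_vanish_isum zs I J j : idealp I -> idealp J ->
  koszul_vanish zs I j -> koszul_vanish zs J j ->
  koszul_vanish zs (icap I J) j.+1 -> koszul_vanish zs (isum I J) j.
Proof.
move=> iI iJ vI vJ vC c cS.
have [w wI wJ] := cochain_split cS.
have [|v vP] := vC w.
  move=> b sb cb; split; first exact: (kosz_in iI wI).
  have -> : kosz zs w b = - kosz zs (fun b => kosz zs c b - w b) b.
    by rewrite koszB kosz_kosz; ring.
  by apply: idealN => //; apply: (kosz_in iJ wJ).
have [|e1 e1P] := vI v.
  move=> b sb cb; have -> : kosz zs v b = w b - (w b - kosz zs v b) by ring.
  by apply: idealB => //; [apply: wI | case: (vP b sb cb)].
have [|e2 e2P] := vJ (fun b => c b - v b).
  move=> b sb cb; rewrite koszB.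
  have -> : kosz zs c b - kosz zs v b =
    (kosz zs c b - w b) + (w b - kosz zs v b) by ring.
  by apply: idealD => //; [apply: wJ | case: (vP b sb cb)].
exists (fun b => e1 b + e2 b) => b sb cb; exists (v b - kosz zs e1 b).
  exact: e1P.
by have := e2P b sb cb; congr (J _); rewrite koszD; ring.
Qed.

Lemma wreg_koszul_vanish zs I s : idealp I ->
  (forall y, y \in s -> gideal (fun z => z \in zs) y) -> wreg I s ->
  forall j, (j < size s)%N -> koszul_vanish zs I j.
Proof.
elim: s I => [|y s IHs] I iI //= sP [ry ws] j js.
have hy : nullhomotopic zs y by apply: nullhomotopic_gideal; apply: sP; apply: mem_head.
case: j js => [_|j js]; first exact: koszul_vanish0_regular iI hy ry.
apply: (koszul_vanish_adj_succ iI hy ry).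
by apply: IHs => //; [exact: idealp_adj | move=> z zs'; apply: sP; rewrite inE zs' orbT].
Qed.

(** Each member of [s] lowers the degree by one. The other vanishing that [koszul_vanish_adj] asks
    for is in a degree below the length of the sequence. *)
Lemma koszul_vanish_adjs zs I s : idealp I ->
  (forall y, y \in s -> gideal (fun z => z \in zs) y) -> wreg I s ->
  koszul_vanish zs I (size s) -> koszul_vanish zs (adjs I s) 0.
Proof.
elim: s I => [|y s IHs] I iI //= sP [ry ws] vI.
have sP' z : z \in s -> gideal (fun z => z \in zs) z.
  by move=> zs'; apply: sP; rewrite inE zs' orbT.
apply: IHs => //; first exact: idealp_adj.
apply: koszul_vanish_adj => //.
by apply: (@wreg_koszul_vanish _ _ (y :: s)) => //=.
Qed.

Lemma koszul_vanish_socle zs I u : idealp I -> koszul_vanish zs I 0 ->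
  (forall z, z \in zs -> I (z * u)) -> I u.
Proof.
move=> iI vI uI; have [|e eP] := vI (fun=> u).
  by move=> b _ _; apply: kosz_scaled => // z _ /uI.
have sb : size (nseq (size zs) false) = size zs by rewrite size_nseq.
have cb : count id (nseq (size zs) false) = 0%N by rewrite count_nseq mul0n.
by have := eP _ sb cb; rewrite kosz_deg0 // subr0.
Qed.

End Koszul.

(** * Substitutions and ideals of linear forms *)

Section MPolyMorphisms.
Variables (K : fieldType) (n : nat).

Lemma mpoly_alg_ind (Q : {mpoly K[n]} -> Prop) :
  (forall c, Q c%:MP) -> (forall i, Q 'X_i) ->
  (forall f g, Q f -> Q g -> Q (f + g)) ->
  (forall f g, Q f -> Q g -> Q (f * g)) -> forall f, Q f.
Proof.
move=> QC QX QD QM f; rewrite (mpolyE f); elim/big_ind: _ => //.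
  by rewrite -mpolyC0.
move=> m _; rewrite -mul_mpolyC; apply: (QM) => //.
rewrite mpolyXE_id; elim/big_ind: _ => //; first by rewrite -mpolyC1.
move=> i _; elim: (m i) => [|j IHj]; first by rewrite expr0 -mpolyC1.
by rewrite exprS; apply: QM.
Qed.

Lemma rmorph_mpoly_ext (A : comNzRingType) (f g : {rmorphism {mpoly K[n]} -> A}) :
  (forall c, f c%:MP = g c%:MP) -> (forall i, f 'X_i = g 'X_i) -> f =1 g.
Proof.
move=> fgC fgX; apply: mpoly_alg_ind => // p q; first by rewrite !rmorphD => -> ->.
by rewrite !rmorphM => -> ->.
Qed.

Definition psubst k (h : 'I_n -> {mpoly K[k]}) : {mpoly K[n]} -> {mpoly K[k]} :=
  mmap (@mpolyC k K) h.
HB.instance Definition _ k (h : 'I_n -> {mpoly K[k]}) :=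
  GRing.RMorphism.copy (psubst h) (mmap (@mpolyC k K) h).

Lemma psubstX k (h : 'I_n -> {mpoly K[k]}) i : psubst h 'X_i = h i.
Proof. by rewrite /psubst mmapX mmap1U. Qed.

Lemma psubstC k (h : 'I_n -> {mpoly K[k]}) c : psubst h c%:MP = c%:MP.
Proof. by rewrite /psubst mmapC. Qed.

Lemma psubstZ k (h : 'I_n -> {mpoly K[k]}) c f : psubst h (c *: f) = c *: psubst h f.
Proof. by rewrite -!mul_mpolyC rmorphM /= psubstC. Qed.

End MPolyMorphisms.

Section Substitution.
Variables (K : fieldType) (n : nat).

Lemma psubst_comp k l (h : 'I_n -> {mpoly K[k]}) (g : 'I_k -> {mpoly K[l]}) f :
  psubst g (psubst h f) = psubst (fun i => psubst g (h i)) f.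
Proof.
pose F : {rmorphism _ -> _} := psubst g \o psubst h.
apply: (rmorph_mpoly_ext (f := F)) => [c|i] /=; first by rewrite !psubstC.
by rewrite !psubstX.
Qed.

Lemma psubst_congr (I : {mpoly K[n]} -> Prop) (h : 'I_n -> {mpoly K[n]}) :
  idealp I -> (forall i, I ('X_i - h i)) -> forall f, I (f - psubst h f).
Proof.
move=> iI Ih; apply: mpoly_alg_ind => [c|i|f g If Ig|f g If Ig].
- by rewrite psubstC subrr; exact: ideal0 iI.
- by rewrite psubstX.
- by rewrite rmorphD opprD addrACA; apply: idealD.
- rewrite rmorphM /= (_ : _ - _ =
    g * (f - psubst h f) + psubst h f * (g - psubst h g)); last by ring.
  by apply: idealD => //; apply: idealM.
Qed.

End Substitution.

Section LinearForms.
Variable K : fieldType.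

Definition lform n (w : 'rV[K]_n) : {mpoly K[n]} := \sum_i w 0 i *: 'X_i.

Lemma lform_is_linear n : linear (@lform n).
Proof.
move=> a u v; rewrite /lform scaler_sumr -big_split /=; apply: eq_bigr => i _.
by rewrite !mxE scalerDl scalerA.
Qed.
HB.instance Definition _ n := GRing.isLinear.Build K 'rV[K]_n {mpoly K[n]} _
  (@lform n) (@lform_is_linear n).

Lemma lform_delta n i : lform (delta_mx 0 i : 'rV_n) = 'X_i.
Proof.
rewrite /lform (bigD1 i) //= big1 => [|j ji]; last first.
  by rewrite mxE /= (negPf ji) scale0r.
by rewrite mxE !eqxx scale1r addr0.
Qed.

Lemma mcoeff_lform n (w : 'rV_n) i : (lform w)@_U_(i) = w 0 i.
Proof.
rewrite /lform raddf_sum (bigD1 i) //= big1 => [|j ji].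
  by rewrite mcoeffZ mcoeffXU eqxx mulr1 addr0.
by rewrite mcoeffZ mcoeffXU (negPf ji) mulr0.
Qed.

Lemma lform_eq0 n (w : 'rV_n) : lform w = 0 -> w = 0.
Proof. by move=> w0; apply/rowP => i; rewrite -mcoeff_lform w0 mcoeff0 mxE. Qed.

Definition lsubst n k (M : 'M[K]_(n, k)) : {mpoly K[n]} -> {mpoly K[k]} :=
  psubst (fun i => lform (row i M)).
HB.instance Definition _ n k (M : 'M[K]_(n, k)) :=
  GRing.RMorphism.copy (lsubst M) (psubst (fun i => lform (row i M))).

Lemma lsubst_lform n k (M : 'M[K]_(n, k)) w : lsubst M (lform w) = lform (w *m M).
Proof.
rewrite {1}/lform raddf_sum mulmx_sum_row linear_sum /=; apply: eq_bigr => i _.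
by rewrite linearZ /= /lsubst psubstZ psubstX.
Qed.

Lemma lsubst_mul n k l (M : 'M[K]_(n, k)) (M' : 'M[K]_(k, l)) f :
  lsubst M' (lsubst M f) = lsubst (M *m M') f.
Proof.
rewrite /lsubst [LHS]psubst_comp; congr (psubst _ f); apply: funext => i.
by rewrite -/(lsubst _ _) lsubst_lform row_mul.
Qed.

Definition Lin n p (A : 'M[K]_(p, n)) : {mpoly K[n]} -> Prop :=
  gideal (fun f => exists2 w, (w <= A)%MS & f = lform w).

Lemma idealp_Lin n p (A : 'M[K]_(p, n)) : idealp (Lin A).
Proof. exact: idealp_gideal. Qed.

Lemma mem_Lin n p (A : 'M[K]_(p, n)) w : (w <= A)%MS -> Lin A (lform w).
Proof. by move=> wA; apply: mem_gideal; exists w. Qed.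

Lemma Lin_sub n p (A : 'M[K]_(p, n)) (I : {mpoly K[n]} -> Prop) : idealp I ->
  (forall w, (w <= A)%MS -> I (lform w)) -> forall f, Lin A f -> I f.
Proof. by move=> iI AI; apply: gideal_sub => // _ [w wA ->]; apply: AI. Qed.

Lemma lsubst_congr n p (A : 'M[K]_(p, n)) (M : 'M[K]_n) f :
  (1%:M - M <= A)%MS -> Lin A (f - lsubst M f).
Proof.
move=> AM; apply: psubst_congr => [|i]; first exact: idealp_Lin.
rewrite -lform_delta -linearB /= -row1 -linearB /=; apply: mem_Lin.
exact: submx_trans (row_sub _ _) AM.
Qed.

Lemma coker_retract n p (A : 'M[K]_(p, n)) :
  (1%:M - cokermx A *m pinvmx (cokermx A) <= A)%MS.
Proof. by rewrite submxE mulmxBl mul1mx mulmxKpV // subrr. Qed.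

(** Substituting the cokernel and then its pseudo-inverse is the identity modulo the rows of [A], so
    the cokernel loses nothing else. Hence the quotient embeds into a polynomial ring and is a
    domain. *)
Lemma LinP n p (A : 'M[K]_(p, n)) f : Lin A f <-> lsubst (cokermx A) f = 0.
Proof.
split=> [|f0].
  apply: (Lin_sub (idealp_ker (lsubst (cokermx A)))).
  by move=> w; rewrite submxE => /eqP wA; rewrite /= lsubst_lform wA linear0.
have := lsubst_congr f (coker_retract A).
by rewrite -lsubst_mul f0 rmorph0 subr0.
Qed.

Lemma Lin_regular n p (A : 'M[K]_(p, n)) w :
  ~~ (w <= A)%MS -> regular (Lin A) (lform w).
Proof.
move=> wA f /LinP; rewrite rmorphM /= lsubst_lform => /eqP.
rewrite mulf_eq0 => /orP[/eqP/lform_eq0 w0|/eqP/LinP //].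
by rewrite submxE w0 eqxx in wA.
Qed.

Lemma adj_Lin n (A : 'M[K]_n) w : adj (Lin A) (lform w) = Lin (A + w)%MS.
Proof.
have iL := idealp_Lin (A + w)%MS; have iA := idealp_Lin A.
apply: pred_eqP => f; split.
  apply: adj_sub => //; last by apply: mem_Lin; apply: addsmxSr.
  by apply: Lin_sub => // v vA; apply: mem_Lin; apply: submx_trans vA (addsmxSl _ _).
apply: Lin_sub => [|v /sub_addsmxP[[u1 u2] /= ->]]; first exact: idealp_adj.
rewrite linearD /=; apply: idealD; first exact: idealp_adj.
  by apply: sub_adj; apply: mem_Lin; apply: submxMl.
rewrite [u2]mx11_scalar mul_scalar_mx linearZ /= -mul_mpolyC.
by apply: idealM; [exact: idealp_adj | exact: mem_adj].
Qed.

(** Linear independence of [ws] modulo the rows of [A], given by a triangular system of dual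
    vectors; these can be written down at single vertices, without computing ranks. *)
Definition dual_indep n (A : 'M[K]_n) (ws : seq 'rV[K]_n) : Prop :=
  forall j, (j < size ws)%N -> exists a : 'cV[K]_n,
    [/\ A *m a = 0, forall i, (i < j)%N -> ws`_i *m a = 0 & ws`_j *m a != 0].

Lemma dual_notin n p (A : 'M[K]_(p, n)) (w : 'rV_n) (a : 'cV_n) :
  A *m a = 0 -> w *m a != 0 -> ~~ (w <= A)%MS.
Proof.
by move=> Aa; apply: contra => /submxP[D ->]; rewrite -mulmxA Aa mulmx0.
Qed.

Lemma adds_mul0 n p q (A : 'M[K]_(p, n)) (w : 'M_(q, n)) (a : 'cV_n) :
  A *m a = 0 -> w *m a = 0 -> (A + w)%MS *m a = 0.
Proof.
move=> Aa wa; have /submxP[D ->] : (A + w <= col_mx A w)%MS by rewrite addsmxE.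
by rewrite -mulmxA mul_col_mx Aa wa col_mx0 mulmx0.
Qed.

Lemma dual_indep_cons n (A : 'M[K]_n) w ws : dual_indep A (w :: ws) ->
  ~~ (w <= A)%MS /\ dual_indep (A + w)%MS ws.
Proof.
move=> dA; split; first by have [a [Aa _]] := dA 0%N isT; apply: dual_notin.
move=> j js; have [a [Aa aj ajj]] := dA j.+1 js; exists a; split=> //.
  by apply: adds_mul0 => //; apply: (aj 0%N).
by move=> i ij; apply: (aj i.+1).
Qed.

Lemma Lin_wreg n (A : 'M[K]_n) ws : dual_indep A ws -> wreg (Lin A) (map (@lform n) ws).
Proof.
elim: ws A => [|w ws IHs] A //= /dual_indep_cons[wA dA].
by split; [exact: Lin_regular | rewrite adj_Lin; apply: IHs].
Qed.

End LinearForms.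

Notation pform p := (lform (row_mx p.1 p.2)).

(** * Maximal minors of a generic matrix with two rows *)

Section Determinantal.
Variables (K : fieldType) (n : nat).
Local Notation S := {mpoly K[n + n]}.
Local Notation T := {mpoly K[n.+1]}.
Implicit Types (a b : 'rV[K]_n) (E : 'M[K]_n) (f g : S).

(** The parametrisation $x_u = t z_u$, $y_u = z_u$ of matrices of rank at most one, with $t$ the
    variable ['X_ord0]. Its values lie in a domain. *)
Definition segre : S -> T :=
  psubst (fun i : 'I_(n + n) => match split i with
    | inl u => 'X_ord0 * 'X_(lift ord0 u)
    | inr u => 'X_(lift ord0 u) end : T).
HB.instance Definition _ := GRing.RMorphism.copy segre (psubst _).

Definition det_ideal : S -> Prop := fun f => segre f = 0.

Definition zform a : T := \sum_i a 0 i *: 'X_(lift ord0 i).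

Lemma zform0 : zform 0 = 0.
Proof. by rewrite /zform big1 // => i _; rewrite mxE scale0r. Qed.

Lemma segre_lform a b : segre (lform (row_mx a b)) = 'X_ord0 * zform a + zform b.
Proof.
rewrite /lform big_split_ord /= rmorphD !rmorph_sum /=; congr (_ + _).
  rewrite mulr_sumr; apply: eq_bigr => i _.
  rewrite row_mxEl [LHS]psubstZ psubstX -[lshift _ _]/(unsplit (inl i)) unsplitK.
  by rewrite -scalerAr.
apply: eq_bigr => i _.
by rewrite row_mxEr [LHS]psubstZ psubstX -[rshift _ _]/(unsplit (inr i)) unsplitK.
Qed.

Definition unsegre : T -> {mpoly K[n]} :=
  psubst (fun j => if unlift ord0 j is Some i then 'X_i else 0 : {mpoly K[n]}).
HB.instance Definition _ := GRing.RMorphism.copy unsegre (psubst _).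

Lemma unsegre_zform a : unsegre (zform a) = lform a.
Proof.
rewrite /zform rmorph_sum; apply: eq_bigr => i _.
by rewrite [LHS]psubstZ psubstX liftK.
Qed.

Lemma segre_form_eq0 a b : 'X_ord0 * zform a + zform b = 0 -> a = 0 /\ b = 0.
Proof.
move=> ab0; have b0 : b = 0.
  apply: lform_eq0; rewrite -unsegre_zform -[RHS](rmorph0 unsegre) -ab0.
  by rewrite [RHS]rmorphD rmorphM [X in X * _]psubstX unlift_none mul0r add0r.
split=> //; apply: lform_eq0; rewrite -unsegre_zform.
move: ab0; rewrite b0 zform0 addr0 => /eqP; rewrite mulf_eq0 => /orP[/eqP X0|/eqP->].
  have := congr1 (mcoeff U_(ord0)) X0.
  by rewrite mcoeffXU eqxx mcoeff0 => /eqP; rewrite oner_eq0.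
by rewrite rmorph0.
Qed.

Definition dblmx E : 'M[K]_(n + n) := block_mx E 0 0 E.

Lemma row_dblmx E a b : row_mx a b *m dblmx E = row_mx (a *m E) (b *m E).
Proof. by rewrite mul_row_block !mulmx0 addr0 add0r. Qed.

Lemma dblmx_mul E (F : 'M_n) : dblmx E *m dblmx F = dblmx (E *m F).
Proof. by rewrite mulmx_block !mulmx0 !mul0mx !addr0 add0r. Qed.

Lemma sub_block_diag p q r (A : 'M[K]_(p, n)) (B : 'M[K]_(q, n))
    (a b : 'M[K]_(r, n)) :
  (row_mx a b <= block_mx A 0 0 B)%MS = (a <= A)%MS && (b <= B)%MS.
Proof.
apply/idP/andP => [/submxP[D]|[/submxP[D ->] /submxP[D' ->]]].
  rewrite -[D]hsubmxK mul_row_block !mulmx0 addr0 add0r => /eq_row_mx[-> ->].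
  by rewrite !submxMl.
apply/submxP; exists (row_mx D D').
by rewrite mul_row_block !mulmx0 addr0 add0r.
Qed.

(** A column operation performed alike on both rows is absorbed by a linear substitution [tau] of
    the $z_u$ that fixes $t$. *)
Lemma segre_dblmx E f : segre f = 0 -> segre (lsubst (dblmx E) f) = 0.
Proof.
pose tau := psubst (fun j => if unlift ord0 j is Some i then zform (row i E)
  else 'X_ord0 : T) : {rmorphism T -> T}.
suff -> : segre (lsubst (dblmx E) f) = tau (segre f) by move=> ->; rewrite rmorph0.
rewrite [LHS]psubst_comp [RHS]psubst_comp; congr (psubst _ f).

have tau_zform a : tau (zform a) = zform (a *m E).
  rewrite /zform rmorph_sum /= -[RHS]/(zform _) mulmx_sum_row.
  pose zf := zform : 'rV_n -> T.
  have zfD : {morph zf : u v / u + v}.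
    by move=> u v; rewrite /zf /zform -big_split; apply: eq_bigr => j _; rewrite mxE scalerDl.
  rewrite -/(zf _) (big_morph zf zfD zform0); apply: eq_bigr => i _.
  rewrite [LHS]psubstZ psubstX liftK /zf /zform scaler_sumr; apply: eq_bigr => j _.
  by rewrite !mxE scalerA.
apply: funext => i; rewrite -/(segre _) -/(tau _) -(splitK i).
rewrite /dblmx /block_mx; case: (split i) => u /=.
  rewrite rowKu row_row_mx row0 segre_lform zform0 addr0.
  rewrite -[lshift _ _]/(unsplit (inl u)) unsplitK [RHS]rmorphM.
  by congr (_ * _); rewrite [RHS]psubstX ?liftK ?unlift_none.
rewrite rowKd row_row_mx row0 segre_lform zform0 mulr0 add0r.
by rewrite -[rshift _ _]/(unsplit (inr u)) unsplitK /= psubstX liftK.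
Qed.

Definition col_ideal E : S -> Prop := isum det_ideal (Lin (dblmx E)).

Lemma idealp_det : idealp det_ideal.
Proof. exact: (idealp_ker segre). Qed.

Lemma idealp_col E : idealp (col_ideal E).
Proof. by apply: idealp_isum; [exact: idealp_det | exact: idealp_Lin]. Qed.

Lemma det_col E f : det_ideal f -> col_ideal E f.
Proof. by apply: sub_isuml; apply: idealp_Lin. Qed.

Lemma Lin_col E f : Lin (dblmx E) f -> col_ideal E f.
Proof. by apply: sub_isumr; apply: idealp_det. Qed.

Lemma dblmx_coker_retract E :
  (1%:M - dblmx (cokermx E *m pinvmx (cokermx E)) <= dblmx E)%MS.
Proof.
rewrite scalar_mx_block opp_block_mx add_block_mx !oppr0 !addr0.
apply/row_subP => i; rewrite -(splitK i) /block_mx; case: (split i) => u /=.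
  rewrite rowKu row_row_mx row0 sub_block_diag sub0mx andbT.
  exact: submx_trans (row_sub _ _) (coker_retract _).
rewrite rowKd row_row_mx row0 sub_block_diag sub0mx /=.
exact: submx_trans (row_sub _ _) (coker_retract _).
Qed.

(** The quotient is again a ring of rank one matrices, with as many independent columns as the
    corank of [E]; as a subring of [T] it is a domain. *)
Lemma col_idealP E f :
  col_ideal E f <-> segre (lsubst (dblmx (cokermx E)) f) = 0.
Proof.
split=> [|f0].
  have iN := idealp_ker (segre \o lsubst (dblmx (cokermx E))).
  apply: (isum_sub iN); first by move=> g; apply: segre_dblmx.
  apply: (Lin_sub iN) => w wE /=.
  rewrite lsubst_lform (_ : w *m _ = 0) ?linear0 ?rmorph0 //.
  have /submxP[D ->] := wE; rewrite -mulmxA dblmx_mul mulmx_coker.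
  by rewrite /dblmx block_mx0 mulmx0.
have fL := lsubst_congr f (dblmx_coker_retract E).
apply: (idealBr (idealp_col E) (Lin_col fL)); apply: det_col.
by rewrite -dblmx_mul -lsubst_mul; apply: segre_dblmx.
Qed.

Lemma col_regular E a b : ~~ ((a <= E)%MS && (b <= E)%MS) ->
  regular (col_ideal E) (lform (row_mx a b)).
Proof.
move=> abE f /col_idealP; rewrite !rmorphM /= lsubst_lform row_dblmx segre_lform => /eqP.
rewrite mulf_eq0 => /orP[/eqP/segre_form_eq0[aE bE]|/eqP/col_idealP //].
by rewrite !submxE aE bE eqxx in abE.
Qed.

Lemma mem_colE E w : (w <= dblmx E)%MS -> col_ideal E (lform w).
Proof. by move=> wE; apply: Lin_col; apply: mem_Lin. Qed.

Lemma adj_adj_col E a :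
  adj (adj (col_ideal E) (lform (row_mx a 0))) (lform (row_mx 0 a)) =
  col_ideal (E + a)%MS.
Proof.
have iE := idealp_col E; have iEa := idealp_col (E + a)%MS.
have aEa : (a <= E + a)%MS by apply: addsmxSr.
set I := adj _ _; have iI : idealp I by do 2?apply: idealp_adj.
apply: pred_eqP => f; split.
  apply: adj_sub => //; last by apply: mem_colE; rewrite sub_block_diag sub0mx.
  apply: adj_sub => //; last by apply: mem_colE; rewrite sub_block_diag sub0mx andbT.
  apply: isum_sub => //; first exact: det_col.
  apply: Lin_sub => // w; rewrite -[w]hsubmxK sub_block_diag => /andP[w1 w2].
  apply: mem_colE; rewrite sub_block_diag.
  by rewrite !(submx_trans _ (addsmxSl _ _)).
have EI g : col_ideal E g -> I g by move=> Eg; do 2!apply: sub_adj.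
apply: isum_sub => //; first by move=> g /(det_col E)/EI.
apply: Lin_sub => // w; rewrite -[w]hsubmxK sub_block_diag.
move=> /andP[/sub_addsmxP[[u1 u2] /= ->] /sub_addsmxP[[v1 v2] /= ->]].
rewrite -add_row_mx linearD /=; apply: idealD => //.
  by apply/EI/mem_colE; rewrite sub_block_diag !submxMl.
rewrite -[row_mx _ _]addr0 -[row_mx (u2 *m a) _]/(row_mx (u2 *m a) (v2 *m a)).
have -> : row_mx (u2 *m a) (v2 *m a) = u2 0 0 *: row_mx a 0 + v2 0 0 *: row_mx 0 a.
  rewrite {1}[u2]mx11_scalar {1}[v2]mx11_scalar !mul_scalar_mx.
  by rewrite !scale_row_mx !scaler0 add_row_mx addr0 add0r.
rewrite addr0 linearD !linearZ /= -!mul_mpolyC; apply: idealD => //.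
  by apply: idealM => //; apply: sub_adj; apply: mem_adj.
by apply: idealM => //; apply: mem_adj; apply: idealp_adj.
Qed.

Definition xcol_ideal E : S -> Prop := Lin (block_mx 1%:M 0 0 E : 'M_(n + n)).

Lemma idealp_xcol E : idealp (xcol_ideal E).
Proof. exact: idealp_Lin. Qed.

Lemma det_xcol E f : det_ideal f -> xcol_ideal E f.
Proof.
move=> f0; pose M : 'M[K]_(n + n) := block_mx 0 0 0 1%:M.
have : Lin (block_mx 1%:M 0 0 E : 'M_(n + n)) (f - lsubst M f).
  apply: lsubst_congr; rewrite scalar_mx_block opp_block_mx add_block_mx.
  rewrite !oppr0 !addr0 subrr.
  apply/row_subP => i; rewrite -(splitK i) /block_mx; case: (split i) => u /=.
    by rewrite rowKu row_row_mx row0 sub_block_diag sub0mx andbT row_sub.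
  by rewrite rowKd row_row_mx row0 sub_block_diag !sub0mx.
suff -> : lsubst M f = 0 by rewrite subr0.
pose tau := psubst (fun j => if unlift ord0 j is Some i then 'X_(rshift n i)
  else 0 : S) : {rmorphism T -> S}.
rewrite -(rmorph0 tau) -f0 [RHS]psubst_comp; congr (psubst _ f).
apply: funext => i; rewrite -/(tau _) -(splitK i) /M /block_mx.
case: (split i) => u /=.
  rewrite rowKu row_row_mx !row0 row_mx0 linear0.
  rewrite -[lshift _ _]/(unsplit (inl u)) unsplitK rmorphM /=.
  by rewrite psubstX unlift_none mul0r.
rewrite rowKd row_row_mx row0 -[rshift _ _ in RHS]/(unsplit (inr u)) unsplitK /=.
by rewrite psubstX liftK row1 -lform_delta delta_mx_rshift.
Qed.

Lemma col_xcol E f : col_ideal E f -> xcol_ideal E f.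
Proof.
have iX := idealp_xcol E.
apply: isum_sub => //; first exact: det_xcol.
apply: Lin_sub => // w; rewrite -[w]hsubmxK sub_block_diag => /andP[_ w2].
by apply: mem_Lin; rewrite sub_block_diag submx1.
Qed.

(* Localising at the column [a] separates the two components of the ideal of
   the section [x(a) = 0]: on one of them all [x] vanish, on the other [y(a)]. *)
Lemma colon_col E a : ~~ (a <= E)%MS ->
  colon (adj (col_ideal E) (lform (row_mx a 0))) (lform (row_mx 0 a)) = xcol_ideal E.
Proof.
move=> aE; have iX := idealp_xcol E; have iE := idealp_col E.
have iI := idealp_adj (lform (row_mx a 0)) iE.
apply: pred_eqP => f; split=> [fI|].
  apply: (@Lin_regular _ _ _ _ (row_mx 0 a)); first by rewrite sub_block_diag sub0mx.
  rewrite mulrC; apply: adj_sub fI => //; first exact: col_xcol.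
  by apply: mem_Lin; rewrite sub_block_diag submx1 sub0mx.
apply: Lin_sub; first exact: idealp_colon.
move=> w; rewrite -[w]hsubmxK sub_block_diag => /andP[_ w2].
set u := lsubmx w; set v := rsubmx w; rewrite /colon.
have -> : row_mx u v = row_mx u 0 + row_mx 0 v by rewrite add_row_mx addr0 add0r.
rewrite linearD mulrDl /=; apply: (idealD iI); last first.
  rewrite mulrC; apply: (idealM iI); apply: sub_adj; apply: mem_colE.
  by rewrite sub_block_diag sub0mx.
exists (lform (row_mx 0 u)); apply: det_col; rewrite /det_ideal.
by rewrite rmorphB !rmorphM /= !segre_lform !zform0; ring.
Qed.

Lemma adj_col_full E a : row_full (E + a)%MS ->
  adj (col_ideal E) (lform (row_mx a 0)) = xcol_ideal E.
Proof.
move=> fE; have iX := idealp_xcol E; have iE := idealp_col E.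
have iI := idealp_adj (lform (row_mx a 0)) iE.
apply: pred_eqP => f; split.
  apply: adj_sub => //; first exact: col_xcol.
  by apply: mem_Lin; rewrite sub_block_diag submx1 sub0mx.
apply: Lin_sub => // w; rewrite -[w]hsubmxK sub_block_diag => /andP[_ w2].
set u := lsubmx w; set v := rsubmx w.
have /sub_addsmxP[[d1 d2] /= uE] : (u <= E + a)%MS by apply: submx_full.
have -> : row_mx u v = row_mx (d1 *m E) v + d2 0 0 *: row_mx a 0.
  rewrite scale_row_mx scaler0 add_row_mx addr0 uE; congr (row_mx (_ + _) _).
  by rewrite {1}[d2]mx11_scalar mul_scalar_mx.
rewrite linearD linearZ /= -mul_mpolyC; apply: (idealD iI).
  by apply: sub_adj; apply: mem_colE; rewrite sub_block_diag submxMl.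
by apply: (idealM iI); apply: mem_adj.
Qed.

Lemma xcol_wreg E (ps : seq ('rV[K]_n * 'rV[K]_n)) : dual_indep E (unzip2 ps) ->
  wreg (xcol_ideal E) [seq lform (row_mx p.1 p.2) | p <- ps].
Proof.
move=> dE; rewrite (map_comp (@lform _ _) (fun p => row_mx p.1 p.2)).
apply: Lin_wreg => j; rewrite size_map => js.
have [|c [cE ci cj]] := dE j; first by rewrite size_map.
have mc a b : row_mx a b *m col_mx 0 c = b *m c.
  by rewrite mul_row_col mulmx0 add0r.
have nthE i : (i < size ps)%N ->
    [seq row_mx p.1 p.2 | p <- ps]`_i *m col_mx 0 c = (unzip2 ps)`_i *m c.
  by move=> si; rewrite !(nth_map 0) // mc.
exists (col_mx 0 c); split.
- by rewrite mul_block_col !mulmx0 mul0mx cE !addr0 col_mx0.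
- by move=> i ij; rewrite nthE ?ci //; apply: ltn_trans ij js.
- by rewrite nthE.
Qed.

(** Modulo [col_ideal E] the first form is just $x(c)$. Then $y(c)$ splits the quotient into the
    linear [xcol_ideal E], where only the $y$-parts of the later forms matter, and the determinantal
    ring without the column [c]. If [E + c] is full, then $x(c) = 0$ already kills all $x$ and only
    the linear piece occurs. *)
Lemma hankel_step E b c ps : (b <= E)%MS -> ~~ (c <= E)%MS ->
  dual_indep E (unzip2 ps) ->
  row_full (E + c)%MS \/ wreg (col_ideal (E + c)%MS) [seq pform p | p <- ps] ->
  wreg (col_ideal E) [seq pform p | p <- (c, b) :: ps].
Proof.
move=> bE cE dE full; have iE := idealp_col E; split.
  by apply: col_regular; rewrite (negPf cE).
have -> : adj (col_ideal E) (lform (row_mx c b)) =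
    adj (col_ideal E) (lform (row_mx c 0)).
  apply: adj_congr => //; rewrite -linearB /= opp_row_mx add_row_mx subrr oppr0 addr0.
  by apply: mem_colE; rewrite sub_block_diag sub0mx.
case: full => [fE|wE]; first by rewrite adj_col_full //; apply: xcol_wreg.
apply: (@wreg_colon _ _ (lform (row_mx 0 c))); first exact: idealp_adj.
  by rewrite colon_col //; apply: xcol_wreg.
by rewrite adj_adj_col.
Qed.

Definition adjrow E (cs : seq 'rV[K]_n) : 'M[K]_n :=
  foldl (fun F c => (F + c)%MS) E cs.

Lemma last_adjrow E b cs : (b <= E)%MS -> (last b cs <= adjrow E cs)%MS.
Proof. by elim: cs E b => //= c cs IHcs E b _; apply/IHcs/addsmxSr. Qed.

Lemma adjrow_mul0 E cs (a : 'cV_n) : E *m a = 0 ->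
  (forall c, c \in cs -> c *m a = 0) -> adjrow E cs *m a = 0.
Proof.
elim: cs E => //= c cs IHcs E Ea csa; apply: IHcs.
  by apply: adds_mul0 => //; apply: csa; rewrite mem_head.
by move=> d dcs; apply: csa; rewrite inE dcs orbT.
Qed.

(* The forms x(c_0) + y(b), x(c_1) + y(c_0), ... of a Hankel specialisation. *)
Lemma hankel_wreg E b cs c' qs :
  (b <= E)%MS -> dual_indep E (cs ++ unzip2 qs) ->
  (cs != [::] /\ row_full (adjrow E cs)) \/
    wreg (col_ideal (adjrow E cs)) [seq pform p | p <- (c', last b cs) :: qs] ->
  wreg (col_ideal E)
    [seq pform p | p <- pairmap (fun b c => (c, b)) b cs ++ (c', last b cs) :: qs].
Proof.
elim: cs E b => [|c cs IHcs] E b bE; first by move=> _ [[]|].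
move=> dE full; have [cE dEc] := dual_indep_cons dE.
apply: hankel_step => //.
  rewrite /unzip2 map_cat /= -/(unzip2 _) -/(unzip2 qs).
  (* Dropping the first pair shifts the $y$-parts by one, so those that remain begin with [c]
     instead of [b]. *)
  suff -> : unzip2 (pairmap (fun b c => (c, b)) c cs) ++ last c cs :: unzip2 qs =
      (c :: cs) ++ unzip2 qs by [].
  by elim: (cs) (c) => //= d ds IHds e; rewrite IHds.
have [/andP[_ fE]|csN] := boolP ((cs == [::]) && row_full (E + c)%MS); first by left.
right; apply: IHcs => //; first exact: addsmxSr.
case: full => [[_ fE]|]; [left | by right].
by split=> //; apply: contra csN => cs0; rewrite cs0 /=; move: fE; rewrite (eqP cs0).
Qed.

End Determinantal.

(** * The kernel of [segre] is generated by the minors *)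

Section Straightening.
Variables (K : fieldType) (n : nat).
Local Notation S := {mpoly K[n + n]}.
Implicit Types (m : 'X_{1..n + n}) (u w : 'I_n) (f g : S).

Definition minor u w : S :=
  'X_(lshift n u) * 'X_(rshift n w) - 'X_(lshift n w) * 'X_(rshift n u).

Definition minors_ideal : S -> Prop :=
  gideal (fun f => exists u w, f = minor u w).

Lemma idealp_minors : idealp minors_ideal.
Proof. exact: idealp_gideal. Qed.

Lemma segreXl u : @segre K n 'X_(lshift n u) = 'X_ord0 * 'X_(lift ord0 u).
Proof. by rewrite [LHS]psubstX -[lshift n u]/(unsplit (inl u)) unsplitK. Qed.

Lemma segreXr u : @segre K n 'X_(rshift n u) = 'X_(lift ord0 u).
Proof. by rewrite [LHS]psubstX -[rshift n u]/(unsplit (inr u)) unsplitK. Qed.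

Lemma minor_det u w : @det_ideal K n (minor u w).
Proof.
by rewrite /det_ideal /minor rmorphB !rmorphM /= !segreXl !segreXr; ring.
Qed.

Lemma minors_det f : minors_ideal f -> det_ideal f.
Proof.
apply: gideal_sub; first exact: idealp_det.
by move=> _ [u [w ->]]; apply: minor_det.
Qed.

Lemma segreZ c f : segre (c *: f) = c *: segre f.
Proof. exact: psubstZ. Qed.

Definition segre_mnm m : 'X_{1..n.+1} :=
  [multinom if unlift ord0 j is Some u then (m (lshift n u) + m (rshift n u))%N
            else (\sum_u m (lshift n u))%N | j < n.+1].

Lemma segreX m : @segre K n 'X_[m] = 'X_[segre_mnm m].
Proof.
rewrite [in LHS]mpolyXE_id rmorph_prod big_split_ord mpolyXE_id big_ord_recl /=.
rewrite mnmE unlift_none -prodrXr.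
rewrite [X in _ = _ * X](eq_bigr (fun u => 'X_(lift ord0 u) ^+ m (lshift n u) *
  'X_(lift ord0 u) ^+ m (rshift n u))); last first.
  by move=> u _; rewrite mnmE liftK exprD.
rewrite big_split /= mulrA; congr (_ * _); rewrite -?big_split; apply: eq_bigr => u _.
  by rewrite rmorphXn /= segreXl exprMn.
by rewrite rmorphXn /= segreXr.
Qed.

Lemma mpolyX_inj k : injective (fun m : 'X_{1..k} => 'X_[m] : {mpoly K[k]}).
Proof.
move=> m m' mE; apply/eqP; have := congr1 (mcoeff m') mE.
rewrite !mcoeffX eqxx; case: eqP => // _ /eqP.
by rewrite eq_sym oner_eq0.
Qed.

Lemma segre_mnmP m m' : segre_mnm m = segre_mnm m' <->
  (\sum_u m (lshift n u) = \sum_u m' (lshift n u))%N /\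
  forall u, (m (lshift n u) + m (rshift n u) = m' (lshift n u) + m' (rshift n u))%N.
Proof.
split=> [mE|[mE mE']].
  split=> [|u].
    by have := congr1 (fun c : 'X_{1..n.+1} => c ord0) mE; rewrite !mnmE unlift_none.
  have := congr1 (fun c : 'X_{1..n.+1} => c (lift ord0 u)) mE.
  by rewrite !mnmE liftK.
by apply/mnmP => j; rewrite !mnmE; case: (unlift ord0 j).
Qed.

Lemma exchange_mnm m u w :
  (0 < m (lshift n u))%N -> (0 < m (rshift n w))%N -> exists m1,
   [/\ minors_ideal ('X_[m] - 'X_[m1]), segre_mnm m1 = segre_mnm m &
       forall t, m1 (lshift n t) = (m (lshift n t) - (t == u) + (t == w))%N].
Proof.
move=> mu mw; pose m0 := (m - (U_(lshift n u) + U_(rshift n w)))%MM.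
have eqlr t t' : (lshift n t == rshift n t') = false by apply: eq_lrshift.
have eqrl t t' : (rshift n t == lshift n t') = false by apply: eq_rlshift.
have mE : m = (m0 + (U_(lshift n u) + U_(rshift n w)))%MM.
  rewrite submK //; apply/mnm_lepP => i; rewrite mnmDE !mnm1E.
  rewrite -(splitK i); case: (split i) => t /=.
    by rewrite eqrl addn0 eq_lshift; case: eqP => // <-.
  by rewrite eqlr eq_rshift; case: eqP => // <-.
pose m1 := (m0 + (U_(lshift n w) + U_(rshift n u)))%MM.
have m1I : minors_ideal ('X_[m] - 'X_[m1]).
  rewrite mE /m1 !mpolyXD -mulrBr; apply: (idealM idealp_minors).
  by apply: mem_gideal; exists u, w.
exists m1; split=> //.
  apply: mpolyX_inj; rewrite /= -!segreX; apply/eqP; rewrite eq_sym -subr_eq0.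
  by rewrite -rmorphB; apply/eqP/minors_det.
move=> t; rewrite /m1 !(mnmDE, mnmBE, mnm1E) !eqrl !eq_lshift !addn0.
by rewrite (eq_sym u) (eq_sym w).
Qed.

(* Two monomials with the same image are linked by exchanges of [x] and [y]
   between two columns. *)
Lemma segre_mnm_congr m m' : segre_mnm m = segre_mnm m' -> minors_ideal ('X_[m] - 'X_[m']).
Proof.
(* The induction is on the total excess of the $x$-exponents of [m] over those of [m'], in truncated
   subtraction; an exchange lowers it. *)
move: {2}(\sum_u (m (lshift n u) - m' (lshift n u)))%N
  (leqnn (\sum_u (m (lshift n u) - m' (lshift n u)))%N) => N.
elim: N m => [|N IHN] m mN mm'; have [sE tE] := (segre_mnmP m m').1 mm'.
  suff -> : m = m' by rewrite subrr; exact: (ideal0 idealp_minors).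
  have le u : (m (lshift n u) <= m' (lshift n u))%N.
    move: mN; rewrite leqn0 sum_nat_eq0 => /forallP/(_ u) /=; lia.
  have eq u : m (lshift n u) = m' (lshift n u).
    have := leqif_sum (fun v (_ : true) => leqif_eq (le v)) => -[_].
    by rewrite sE eqxx => /esym/forallP/(_ u)/eqP.
  apply/mnmP => i; rewrite -(splitK i); case: (split i) => u /=; first exact: eq.
  by have := tE u; rewrite eq => /addnI.
have [/eqP s0|] := boolP (\sum_u (m (lshift n u) - m' (lshift n u)) == 0)%N.
  by apply: IHN => //; rewrite s0.
rewrite sum_nat_eq0 negb_forall => /existsP[u /=]; rewrite -lt0n subn_gt0 => mu.
(* The total $x$-degrees agree, so an excess at [u] forces a deficit at some [w]. As the degrees in
   the column [w] agree too, [m] contains a $y$ there to exchange. *)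
have [w mw] : exists w, (m (lshift n w) < m' (lshift n w))%N.
  apply/existsP; rewrite -[X in is_true X]negbK negb_exists; apply/negP => /forallP le.
  have {}le v : (m' (lshift n v) <= m (lshift n v))%N by rewrite leqNgt.
  have := leqif_sum (fun v (_ : true) => leqif_eq (le v)) => -[_].
  by rewrite sE eqxx => /esym/forallP/(_ u)/eqP; lia.
have [|//|m1 [m1I m1E m1l]] := @exchange_mnm m u w; first lia.
  by have := tE w; lia.
rewrite -(subrKA 'X_[m1]) addrC; apply: (idealD idealp_minors) => //.
apply: IHN; last by rewrite m1E.
have uw : u != w by apply: contraTneq mu => ->; lia.
rewrite -ltnS; apply: leq_trans mN.
rewrite (bigD1 u) //= [X in (_ < X)%N](bigD1 u) //= -addSn; apply: leq_add.
  by rewrite m1l eqxx (negPf uw); lia.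
apply: leq_sum => t tu; rewrite m1l (negPf tu); case: eqP => [->|_]; lia.
Qed.

(** Since [segre] takes monomials to monomials, each monomial of a kernel element shares its image
    with another one of the support. Subtracting a multiple of their difference, a combination of
    minors, removes the first without adding a new one. *)
Lemma det_minors f : det_ideal f -> minors_ideal f.
Proof.
have iM := idealp_minors.
have [N] := ubnP (size (msupp f)); elim: N f => // N IHN f fN f0.
have [/eqP|] := boolP (msupp f == [::]); first by move/msuppnil0->; exact: (ideal0 iM).
case sf : (msupp f) => [//|m ms] _.
have mf : m \in msupp f by rewrite sf mem_head.
have [m' m'f /andP[m'm mm']] :
    exists2 m', m' \in msupp f & (m' != m) && (segre_mnm m' == segre_mnm m).
  apply/hasP; apply/negPn/negP => /hasPn nm.
  have := congr1 (mcoeff (segre_mnm m)) f0; rewrite mcoeff0 {1}[f]mpolyE.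
  rewrite rmorph_sum raddf_sum (bigD1_seq m) ?msupp_uniq //=.
  rewrite big_seq_cond big1 => [|c /andP[cf cm]].
    rewrite addr0 segreZ segreX mcoeffZ mcoeffX.
    by rewrite eqxx mulr1 => /eqP; rewrite mcoeff_eq0 mf.
  rewrite segreZ segreX mcoeffZ mcoeffX.
  by have := nm c cf; rewrite cm /= => /negPf->; rewrite mulr0.
have I1 : minors_ideal (f@_m *: ('X_[m] - 'X_[m'])).
  by rewrite -mul_mpolyC; apply: (idealM iM); apply: segre_mnm_congr; rewrite (eqP mm').
rewrite -[f](subrK (f@_m *: ('X_[m] - 'X_[m']))); apply: (idealD iM) => //.
set f' := f - _; have f'0 : det_ideal f'.
  by apply: (idealB (@idealp_det K n)) => //; apply: minors_det.
have f'c c : f'@_c = f@_c - f@_m * ((m == c)%:R - (m' == c)%:R).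
  by rewrite mcoeffB mcoeffZ mcoeffB !mcoeffX.
have sub : {subset msupp f' <= ms}.
  move=> c; rewrite mcoeff_msupp f'c; have [<-|cm] := eqVneq m c.
    by rewrite (negPf m'm) subr0 mulr1 subrr eqxx.
  have [<-|cm'] := eqVneq m' c.
    by move: m'f; rewrite sf inE (negPf m'm).
  by rewrite subr0 mulr0 subr0 -mcoeff_msupp sf inE eq_sym (negPf cm).
apply: IHN => //; apply: leq_ltn_trans (uniq_leq_size (msupp_uniq _) sub) _.
by move: fN; rewrite sf /= ltnS.
Qed.

End Straightening.

(** * Binomial edge ideals of complete multipartite graphs *)

Section Functionals.
Variables (K : fieldType) (V : finType).
Local Notation S := (bei_ring K V).
Implicit Types (al : V -> K) (D : pred V) (u v w : V).

Definition rowfn al : 'rV[K]_#|V| := \row_j al (enum_val j).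
Definition ptrow v : 'rV[K]_#|V| := delta_mx 0 (enum_rank v).
Definition ptcol v : 'cV[K]_#|V| := delta_mx (enum_rank v) 0.
Definition supp_mx D : 'M[K]_#|V| := diag_mx (rowfn (fun v => (D v)%:R)).

Lemma rowfn_ptcol al v : rowfn al *m ptcol v = (al v)%:M.
Proof.
by rewrite -colE; apply/matrixP => i j; rewrite !ord1 !mxE enum_rankK eqxx.
Qed.

Lemma ptrowE v : ptrow v = rowfn (fun u => (u == v)%:R).
Proof.
apply/rowP => j; rewrite !mxE eqxx /=; congr (_%:R); congr nat_of_bool.
by apply/eqP/eqP => [->|<-]; rewrite ?enum_rankK ?enum_valK.
Qed.

Lemma scalar1_eq0 (c : K) : (c%:M == 0 :> 'M_1) = (c == 0).
Proof.
apply/eqP/eqP => [/matrixP/(_ 0 0)|->]; last by rewrite raddf0.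
by rewrite !mxE eqxx mulr1n.
Qed.

Lemma rowfn_supp al D : rowfn al *m supp_mx D = rowfn (fun v => al v * (D v)%:R).
Proof. by apply/rowP => j; rewrite mul_mx_diag !mxE. Qed.

Lemma rowfn_sub_supp al D : (forall v, ~~ D v -> al v = 0) -> (rowfn al <= supp_mx D)%MS.
Proof.
move=> alD; apply/submxP; exists (rowfn al); rewrite rowfn_supp.
apply/rowP => j; rewrite !mxE; case: (boolP (D _)) => [_|/alD->]; last by rewrite mul0r.
by rewrite mulr1.
Qed.

Lemma ptrow_sub_supp v D : D v -> (ptrow v <= supp_mx D)%MS.
Proof.
move=> Dv; rewrite ptrowE; apply: rowfn_sub_supp => u.
by case: eqP => // ->; rewrite Dv.
Qed.

Lemma supp_ptcol v D : ~~ D v -> supp_mx D *m ptcol v = 0.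
Proof.
move=> nDv; apply/colP => j; rewrite mul_diag_mx !mxE /=.
have [->|] := eqVneq j (enum_rank v); last by rewrite mulr0.
by rewrite enum_rankK (negPf nDv) mul0r.
Qed.

Lemma xvarE v : xvar K v = lform (row_mx (ptrow v) 0).
Proof. by rewrite -delta_mx_lshift lform_delta. Qed.

Lemma yvarE v : yvar K v = lform (row_mx 0 (ptrow v)).
Proof. by rewrite -delta_mx_rshift lform_delta. Qed.

Lemma Lin_supp_sub D (J : S -> Prop) : idealp J ->
  (forall v, D v -> J (xvar K v)) -> (forall v, D v -> J (yvar K v)) ->
  forall f, Lin (dblmx (supp_mx D)) f -> J f.
Proof.
move=> iJ Jx Jy; apply: Lin_sub => // w /submxP[c ->]; rewrite -[c]hsubmxK row_dblmx.
have supp d : (d *m supp_mx D) = \sum_(v | D v) d 0 (enum_rank v) *: ptrow v.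
  rewrite mulmx_sum_row (reindex _ (onW_bij _ (enum_rank_bij V))) /=.
  rewrite [RHS]big_mkcond; apply: eq_bigr => v _.
  rewrite row_diag_mx mxE enum_rankK; case: ifP => _; first by rewrite scale1r.
  by rewrite scale0r scaler0.
set a := lsubmx c; set b := rsubmx c.
rewrite -[row_mx _ _]/(row_mx (a *m _) (b *m _)).
have -> : row_mx (a *m supp_mx D) (b *m supp_mx D) =
    row_mx (a *m supp_mx D) 0 + row_mx 0 (b *m supp_mx D).
  by rewrite add_row_mx addr0 add0r.
rewrite linearD /=; apply: (idealD iJ).
  rewrite supp (big_morph (fun r => row_mx r 0) (id1 := 0) (op1 := +%R)).
  - rewrite linear_sum; apply: ideal_sum => // v Dv.
    rewrite -[X in row_mx _ X](scaler0 _ (a 0 (enum_rank v))) -scale_row_mx linearZ /=.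
    by rewrite -mul_mpolyC; apply: (idealM iJ); rewrite -xvarE; apply: Jx.
  - by move=> x y; rewrite add_row_mx addr0.
  - by rewrite row_mx0.
rewrite supp (big_morph (fun r => row_mx 0 r) (id1 := 0) (op1 := +%R)).
- rewrite linear_sum; apply: ideal_sum => // v Dv.
  rewrite -[X in row_mx X _](scaler0 _ (b 0 (enum_rank v))) -scale_row_mx linearZ /=.
  by rewrite -mul_mpolyC; apply: (idealM iJ); rewrite -yvarE; apply: Jy.
- by move=> x y; rewrite add_row_mx addr0.
- by rewrite row_mx0.
Qed.

Lemma mem_Lin_supp_x D v : D v -> Lin (dblmx (supp_mx D)) (xvar K v).
Proof.
move=> Dv; rewrite xvarE; apply: mem_Lin.
by rewrite sub_block_diag sub0mx andbT ptrow_sub_supp.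
Qed.

Lemma mem_Lin_supp_y D v : D v -> Lin (dblmx (supp_mx D)) (yvar K v).
Proof.
by move=> Dv; rewrite yvarE; apply: mem_Lin; rewrite sub_block_diag sub0mx ptrow_sub_supp.
Qed.

Definition edge_binomial u w : S := xvar K u * yvar K w - xvar K w * yvar K u.

Definition edge_ideal (e : rel V) : S -> Prop :=
  gideal (fun f => exists u w, e u w /\ f = edge_binomial u w).

Lemma idealp_edge e : idealp (edge_ideal e).
Proof. exact: idealp_gideal. Qed.

Lemma mem_edge (e : rel V) u w : e u w -> edge_ideal e (edge_binomial u w).
Proof. by move=> euw; apply: mem_gideal; exists u, w. Qed.

Lemma edge_ideal_sub (e : rel V) (J : S -> Prop) : idealp J ->
  (forall u w, e u w -> J (edge_binomial u w)) -> forall f, edge_ideal e f -> J f.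
Proof. by move=> iJ eJ; apply: gideal_sub => // _ [u [w [euw ->]]]; apply: eJ. Qed.

Lemma edge_binomial_det u w : det_ideal (edge_binomial u w).
Proof. exact: minor_det. Qed.

Lemma edge_ideal_complete (e : rel V) :
  (forall u w, e u w) -> edge_ideal e = @det_ideal K _.
Proof.
move=> eT; apply: pred_eqP => f; split.
  by apply: edge_ideal_sub => [|u w _]; [exact: idealp_det | exact: edge_binomial_det].
move=> /det_minors; apply: gideal_sub; first exact: idealp_edge.
move=> _ [i [j ->]]; have := mem_edge (eT (enum_val i) (enum_val j)).
by rewrite /edge_binomial /xvar /yvar !enum_valK.
Qed.

Definition supp_proj D : S -> S := lsubst (dblmx (1%:M - supp_mx D)).
HB.instance Definition _ D := GRing.RMorphism.copy (supp_proj D)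
  (lsubst (dblmx (1%:M - supp_mx D))).

Lemma supp_projP D f : Lin (dblmx (supp_mx D)) f <-> supp_proj D f = 0.
Proof.
split.
  apply: (Lin_sub (idealp_ker (supp_proj D))) => w /submxP[c ->] /=.
  rewrite [LHS]lsubst_lform -mulmxA dblmx_mul.
  suff -> : supp_mx D *m (1%:M - supp_mx D) = 0.
    by rewrite /dblmx block_mx0 mulmx0 linear0.
  rewrite mulmxBr mulmx1 mul_diag_mx; apply/matrixP => i j; rewrite !mxE.
  by case: eqP => _; case: (D _); rewrite ?mulr0n ?mulr1n ?mulr0 ?mulr1 ?subrr.
move=> f0; rewrite -[f]subr0 -f0; apply: lsubst_congr.
rewrite scalar_mx_block opp_block_mx add_block_mx !oppr0 !addr0.
by rewrite opprB addrC subrK.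
Qed.

Lemma supp_proj_x D v : ~~ D v -> supp_proj D (xvar K v) = xvar K v.
Proof.
move=> nDv; rewrite xvarE [LHS]lsubst_lform row_dblmx mul0mx mulmxBr mulmx1.
rewrite [in X in _ - X]ptrowE rowfn_supp (_ : rowfn _ = 0) ?subr0 //.
apply/rowP => j; rewrite !mxE; case: eqP => [->|_]; last by rewrite mul0r.
by rewrite (negPf nDv) mulr0.
Qed.

Lemma supp_proj_y D v : ~~ D v -> supp_proj D (yvar K v) = yvar K v.
Proof.
move=> nDv; rewrite yvarE [LHS]lsubst_lform row_dblmx mul0mx mulmxBr mulmx1.
rewrite [in X in _ - X]ptrowE rowfn_supp (_ : rowfn _ = 0) ?subr0 //.
apply/rowP => j; rewrite !mxE; case: eqP => [->|_]; last by rewrite mul0r.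
by rewrite (negPf nDv) mulr0.
Qed.

End Functionals.

(** * Turning one part from a clique into an independent set *)

Section Multipartite.
Variables (K : fieldType) (V I : finType) (part : V -> I).
Local Notation S := (bei_ring K V).
Implicit Types (T : {set I}) (i : I) (u v w : V) (f g : S).

(* The parts in [T] are independent sets, the other ones are cliques. *)
Definition mp_rel T : rel V := fun u w => (part u != part w) || (part u \notin T).

Definition off i : pred V := fun v => part v != i.

Definition off_ideal i : S -> Prop := Lin (dblmx (supp_mx K (off i))).

Lemma idealp_off i : idealp (off_ideal i).
Proof. exact: idealp_Lin. Qed.

Lemma edge_binomial_off i u w : off i u || off i w -> off_ideal i (edge_binomial K u w).
Proof.
have iO := idealp_off i; case/orP => o; rewrite /edge_binomial.
  apply: (idealB iO); first by rewrite mulrC; apply: (idealM iO); apply: mem_Lin_supp_x.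
  by apply: (idealM iO); apply: mem_Lin_supp_y.
apply: (idealB iO); first by apply: (idealM iO); apply: mem_Lin_supp_y.
by rewrite mulrC; apply: (idealM iO); apply: mem_Lin_supp_x.
Qed.

(** Once part [i] is independent, every edge has an endpoint outside of it. *)
Lemma edge_off T i f : edge_ideal (mp_rel (i |: T)) f -> off_ideal i f.
Proof.
apply: edge_ideal_sub => [|u w uw]; first exact: idealp_off.
apply: edge_binomial_off; move: uw; rewrite /mp_rel /off !inE negb_or.
by have [->|//] := eqVneq (part u) i; rewrite /= orbF eq_sym.
Qed.

(* The Pluecker relations show that the variables outside of a part annihilate
   the binomials of the pairs in this part modulo the edge ideal. *)
Lemma off_edge_binomial T i u w q : i \in T -> part u = i -> part w = i ->
  off_ideal i q -> edge_ideal (mp_rel T) (q * edge_binomial K u w).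
Proof.
move=> iT ui wi; have iE := idealp_edge K (mp_rel T).
have mE v z : off i v -> part z = i -> edge_ideal (mp_rel T) (edge_binomial K v z).
  by move=> vi zi; apply: mem_edge; rewrite /mp_rel zi; rewrite /off in vi; rewrite vi.
have mE' v z : off i v -> part z = i -> edge_ideal (mp_rel T) (edge_binomial K z v).
  move=> vi zi; rewrite (_ : edge_binomial K z v = - edge_binomial K v z).
    by apply: (idealN iE); apply: mE.
  by rewrite /edge_binomial; ring.
apply: (Lin_supp_sub (J := fun q => edge_ideal (mp_rel T) (q * edge_binomial K u w))).
- exact: (idealp_colon (edge_binomial K u w) iE).
- move=> v vi; rewrite (_ : _ * _ = xvar K u * edge_binomial K v w -
    xvar K w * edge_binomial K v u); last by rewrite /edge_binomial; ring.
  by apply: (idealB iE); apply: (idealM iE); apply: mE.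
- move=> v vi; rewrite (_ : _ * _ = yvar K u * edge_binomial K v w -
    yvar K w * edge_binomial K v u); last by rewrite /edge_binomial; ring.
  by apply: (idealB iE); apply: (idealM iE); apply: mE.
Qed.

Lemma edge_ideal_setU1 T i : i \notin T ->
  edge_ideal (mp_rel (i |: T)) = icap (edge_ideal (mp_rel T)) (off_ideal i).
Proof.
move=> iT; set E' := edge_ideal _; have iE' : idealp E' by apply: idealp_edge.
have iE := idealp_edge K (mp_rel T).
apply: pred_eqP => f; split=> [Ef|[Ef Of]].
  split; last exact: edge_off Ef.
  apply: edge_ideal_sub Ef => // u w uw; apply: mem_edge; move: uw.
  by rewrite /mp_rel !inE negb_or; case: eqP => //= _ /andP[].
(* Both conditions hold for the generators of the larger edge ideal. The second one makes the first
   stable under multiplication, so that [W] is an ideal; on [off_ideal i] the projection vanishes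
   and the first condition becomes membership in [E']. *)
pose W g := E' (g - supp_proj (off i) g) /\ forall q, off_ideal i q -> E' (q * g).
have iW : idealp W.
  split.
  - split; first by rewrite rmorph0 subrr; apply: (ideal0 iE').
    by move=> q _; rewrite mulr0; apply: (ideal0 iE').
  - move=> g h [g1 g2] [h1 h2]; split.
      by rewrite rmorphD opprD addrACA; apply: (idealD iE').
    by move=> q Oq; rewrite mulrDr; apply: (idealD iE'); [apply: g2|apply: h2].
  - move=> a g [g1 g2]; split; last first.
      by move=> q Oq; rewrite mulrCA; apply: (idealM iE'); apply: g2.
    have Oa : off_ideal i (a - supp_proj (off i) a).
      apply: lsubst_congr.
      rewrite scalar_mx_block opp_block_mx add_block_mx !oppr0 !addr0.
      by rewrite opprB addrC subrK.
    rewrite rmorphM /= (_ : _ - _ = supp_proj (off i) a * (g - supp_proj (off i) g) +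
      (a - supp_proj (off i) a) * g); last by ring.
    by apply: (idealD iE'); [apply: (idealM iE') | apply: g2].
suff [+ _] : W f by have /supp_projP -> := Of; rewrite subr0.
apply: edge_ideal_sub Ef => // u w uw.
have [uw'|uw'] := boolP (mp_rel (i |: T) u w).
  have Euw : E' (edge_binomial K u w) by apply: mem_edge.
  split; last by move=> q _; apply: (idealM iE').
  by have /edge_off/supp_projP -> := Euw; rewrite subr0.
have [ui wi] : part u = i /\ part w = i.
  move: uw uw'; rewrite /mp_rel negb_or !negbK !inE; case: eqP => //= <- uT.
  by rewrite (negPf uT) orbF => /eqP.
have nu : ~~ off i u by rewrite /off ui eqxx.
have nw : ~~ off i w by rewrite /off wi eqxx.
split; last by move=> q; apply: off_edge_binomial; rewrite ?setU11.
rewrite rmorphB !rmorphM /= !supp_proj_x // !supp_proj_y // subrr.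
exact: (ideal0 iE').
Qed.

(** The minors missing from the edge ideal belong to pairs inside a part of [T]. That part is not
    [i], so these minors lie in [off_ideal i]. *)
Lemma isum_edge_off T i : i \notin T ->
  isum (edge_ideal (mp_rel T)) (off_ideal i) = col_ideal (supp_mx K (off i)).
Proof.
move=> iT; have iE := idealp_edge K (mp_rel T); have iO := idealp_off i.
have iC := idealp_col (supp_mx K (off i)).
apply: pred_eqP => f; split; apply: isum_sub => //.
- apply: edge_ideal_sub => // u w _; apply: det_col; exact: edge_binomial_det.
- by move=> g; apply: Lin_col.
- exact: idealp_isum.
- move=> g; rewrite -(@edge_ideal_complete _ _ (fun _ _ => true)) //.
  apply: edge_ideal_sub => [|u w _]; first exact: idealp_isum.
  have [uw|] := boolP (mp_rel T u w).
    by apply: sub_isuml => //; apply: mem_edge.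
  rewrite negb_or !negbK => /andP[_ uT]; apply: sub_isumr => //.
  by apply: edge_binomial_off; rewrite /off; case: eqP iT => //= <-; rewrite uT.
- by move=> g; apply: sub_isumr.
Qed.

Lemma wreg_edge s t : (forall i, wreg (off_ideal i) (rcons s t)) ->
  (forall i, wreg (col_ideal (supp_mx K (off i))) s) ->
  wreg (@det_ideal K _) (rcons s t) ->
  forall T, wreg (edge_ideal (mp_rel T)) (rcons s t).
Proof.
move=> wO wC wD T; have [N] := ubnP #|T|; elim: N T => // N IHN T TN.
have [->|[i iT]] := set_0Vmem T.
  by rewrite edge_ideal_complete // => u w; rewrite /mp_rel inE orbT.
rewrite -(setD1K iT) edge_ideal_setU1 ?setD11 //.
have iN : i \notin T :\ i by rewrite setD11.
apply: wreg_cap => //; [exact: idealp_edge | exact: idealp_off | | ].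
  by apply: IHN; rewrite (cardsD1 i) iT in TN.
by rewrite isum_edge_off.
Qed.

End Multipartite.

(** * The regular sequence and the socle *)

Section HankelSequence.
Variables (K : fieldType) (V I : finType) (part : V -> I) (i0 i1 : I).
Variables (sz : I -> nat) (rk : V -> nat) (vx : I -> nat -> V).
Hypothesis i10 : i1 != i0.
Hypothesis rk_lt : forall v, (rk v < sz (part v))%N.
Hypothesis vxK : forall v, vx (part v) (rk v) = v.
Hypothesis part_vx : forall i j, (j < sz i)%N -> part (vx i j) = i.
Hypothesis rk_vx : forall i j, (j < sz i)%N -> rk (vx i j) = j.
Local Notation m := (sz i0).
Hypothesis m2 : (2 <= m)%N.
Hypothesis m_min : forall i, (m <= sz i)%N.

Local Notation S := (bei_ring K V).
Local Notation n := #|V|.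
Implicit Types (i : I) (j : nat) (v u w : V).

(* On a part of size [m] the [m + 1] Hankel forms exhaust the rows of rank below
   [m], but a larger part and the whole matrix need a new column in the last of
   them: this is the role of the rank [m] vertices, resp. of the rank [0]
   vertices outside of [i0], in [extra_row]. *)
Definition rank_row j : 'rV[K]_n := rowfn (fun v => (rk v == j)%:R).
Definition extra_row : 'rV[K]_n :=
  rowfn (fun v => ((part v != i0) && ((rk v == 0) || (rk v == m)))%:R).
Definition last_xrow : 'rV[K]_n := rowfn (fun v => ((part v == i0) && (rk v == 1))%:R).
Definition last_yrow : 'rV[K]_n := rowfn (fun v => ((part v != i0) && (rk v == 0))%:R).

Definition hankel_pair j : 'rV[K]_n * 'rV[K]_n :=
  (if j == m then extra_row else rank_row j, if j is j'.+1 then rank_row j' else 0).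

Definition hankel_pairs := mkseq hankel_pair m.+1.
(** On each part exactly one of the two rows is nonzero. So on every part the form takes the value
    $1$ or $-1$, in any characteristic, at the vector [socle_dual] that all Hankel forms
    annihilate. *)
Definition last_pair := (last_xrow, last_yrow).
Definition hankel_seq : seq S := [seq pform p | p <- hankel_pairs].
Definition theta : seq S := rcons hankel_seq (pform last_pair).

Local Notation cs := (mkseq rank_row m).

Lemma hankel_pair2 j : (0 < j)%N -> (hankel_pair j).2 = rank_row j.-1.
Proof. by case: j. Qed.

Lemma hankel_pairsE : hankel_pairs =
  pairmap (fun b c => (c, b)) 0 cs ++ [:: (extra_row, last 0 cs)].
Proof.
rewrite /hankel_pairs mkseqS -cats1; congr (_ ++ [:: _]).
  apply: (@eq_from_nth _ (0, 0)) => [|j]; rewrite size_mkseq ?size_pairmap ?size_mkseq //.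
  move=> jm; rewrite nth_mkseq // (nth_pairmap 0) ?size_mkseq // nth_mkseq //.
  rewrite /hankel_pair ltn_eqF //; congr (_, _).
  by case: j jm => //= j jm; rewrite nth_mkseq // ltnW.
rewrite /hankel_pair eqxx; congr (_, _).
case: (m) m2 => // k _; rewrite mkseqS last_rcons //.
Qed.

Lemma theta_pairs : theta = [seq pform p | p <-
  pairmap (fun b c => (c, b)) 0 cs ++ (extra_row, last 0 cs) :: [:: last_pair]].
Proof.
by rewrite /theta /hankel_seq hankel_pairsE -map_rcons -cats1 -catA.
Qed.

Lemma size_hankel_seq : size hankel_seq = m.+1.
Proof. by rewrite size_map size_mkseq. Qed.

Lemma rank_row_vx j i k : (k < sz i)%N -> rank_row j *m ptcol K (vx i k) = (k == j)%:R%:M.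
Proof. by move=> ki; rewrite rowfn_ptcol rk_vx. Qed.

Lemma extra_row_vx i k : (k < sz i)%N ->
  extra_row *m ptcol K (vx i k) = ((i != i0) && ((k == 0) || (k == m)))%:R%:M.
Proof. by move=> ki; rewrite rowfn_ptcol rk_vx // part_vx. Qed.

Lemma last_xrow_vx i k : (k < sz i)%N ->
  last_xrow *m ptcol K (vx i k) = ((i == i0) && (k == 1))%:R%:M.
Proof. by move=> ki; rewrite rowfn_ptcol rk_vx // part_vx. Qed.

Lemma last_yrow_vx i k : (k < sz i)%N ->
  last_yrow *m ptcol K (vx i k) = ((i != i0) && (k == 0))%:R%:M.
Proof. by move=> ki; rewrite rowfn_ptcol rk_vx // part_vx. Qed.

Definition vx_rows := (rank_row_vx, extra_row_vx, last_xrow_vx, last_yrow_vx).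

Lemma sz_gt0 i : (0 < sz i)%N. Proof. by have := m_min i; lia. Qed.
Lemma sz_gt1 i : (1 < sz i)%N. Proof. by have := m_min i; lia. Qed.

Lemma cs_mul0 (a : 'cV_n) : (forall j, (j < m)%N -> rank_row j *m a = 0) ->
  forall c, c \in cs -> c *m a = 0.
Proof. by move=> a0 c /mapP[j + ->]; rewrite mem_iota => /andP[_ /a0]. Qed.

Lemma col_ideal0 : col_ideal 0 = @det_ideal K n.
Proof.
apply: pred_eqP => f; split; last exact: det_col.
apply: isum_sub; [exact: idealp_det | by [] | ].
apply: Lin_sub => [|w]; first exact: idealp_det.
rewrite /dblmx block_mx0 submx0 => /eqP->; rewrite linear0.
exact: (ideal0 (@idealp_det K n)).
Qed.

Lemma theta_wreg_det : wreg (@det_ideal K n) theta.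
Proof.
(* The rank rows do not distinguish parts, so they vanish on a difference of two vertices of equal
   rank; at rank 0, [extra_row] and [last_yrow] tell [i1] from [i0]. *)
pose a : 'cV[K]_n := ptcol K (vx i1 0) - ptcol K (vx i0 0).
have rank_a j : rank_row j *m a = 0.
  by rewrite mulmxBr !vx_rows ?sz_gt0 // subrr.
have last_a : last_yrow *m a != 0.
  rewrite mulmxBr !vx_rows ?sz_gt0 // i10 eqxx /= raddf0 subr0.
  by rewrite scalar1_eq0 oner_eq0.
have adj_a : adjrow 0 cs *m a = 0.
  by apply: adjrow_mul0; [rewrite mul0mx | apply: cs_mul0].
rewrite -col_ideal0 theta_pairs; apply: hankel_wreg; first exact: sub0mx.
  move=> j; rewrite size_cat size_mkseq /= addn1 ltnS => jm.
  have nthE (l : nat) : (l < m)%N -> (cs ++ [:: last_yrow])`_l = rank_row l.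
    by move=> im; rewrite nth_cat size_mkseq im nth_mkseq.
  have [jm'|jm'] := ltnP j m.
    exists (ptcol K (vx i0 j)); rewrite mul0mx; split=> //.
      move=> l lj; rewrite nthE ?vx_rows //; last exact: ltn_trans lj jm'.
      by rewrite gtn_eqF // raddf0.
    by rewrite nthE // vx_rows // eqxx scalar1_eq0 oner_eq0.
  have -> : j = m by apply/eqP; rewrite eqn_leq jm.
  exists a; rewrite mul0mx; split=> // [l lm|]; first by rewrite nthE.
  by rewrite nth_cat size_mkseq ltnn subnn.
right; apply: hankel_step.
- by apply: last_adjrow; apply: sub0mx.
- apply: dual_notin adj_a _; rewrite mulmxBr !vx_rows ?sz_gt0 // i10 eqxx /= raddf0 subr0.
  by rewrite scalar1_eq0 oner_eq0.
- by case=> // _; exists a; split.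
right; split=> //; apply: col_regular.
(* Now rank 1 is used: [extra_row] vanishes there, 1 being neither 0 nor [m], while [last_xrow] sees
   the vertex in [i0]. *)
apply/nandP; left; apply: (dual_notin (a := ptcol K (vx i0 1) - ptcol K (vx i1 1))).
  apply: adds_mul0.
    apply: adjrow_mul0; first by rewrite mul0mx.
    by apply: cs_mul0 => j _; rewrite mulmxBr !vx_rows ?sz_gt1 // subrr.
  by rewrite mulmxBr !vx_rows ?sz_gt1 // eqxx (ltn_eqF m2) !andbF /= subrr.
rewrite mulmxBr !vx_rows ?sz_gt1 // eqxx (negPf i10) /= raddf0 subr0.
by rewrite scalar1_eq0 oner_eq0.
Qed.

Lemma sub_adjrow (E : 'M[K]_n) ds : (E <= adjrow E ds)%MS.
Proof.
elim: ds E => //= d ds IHds E; exact: submx_trans (addsmxSl _ _) (IHds _).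
Qed.

Lemma mem_adjrow (E : 'M[K]_n) ds d : d \in ds -> (d <= adjrow E ds)%MS.
Proof.
elim: ds E => //= c ds IHds E; rewrite inE => /predU1P[->|/IHds //].
exact: submx_trans (addsmxSr _ _) (sub_adjrow _ _).
Qed.

Lemma off_vx i k : (k < sz i)%N -> ~~ off part i (vx i k).
Proof. by move=> ki; rewrite /off part_vx ?eqxx. Qed.

Lemma rank_row_off i v : part v = i ->
  (rank_row (rk v) - ptrow K v <= supp_mx K (off part i))%MS.
Proof.
move=> vi; have -> : rank_row (rk v) - ptrow K v =
    rowfn (fun u => (rk u == rk v)%:R - (u == v)%:R).
  by rewrite ptrowE; apply/rowP => j; rewrite !mxE.
apply: rowfn_sub_supp => u; rewrite /off negbK => /eqP ui.
have -> : (rk u == rk v) = (u == v); last by rewrite subrr.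
by apply/eqP/eqP => [uv|->//]; rewrite -[u]vxK -[v]vxK ui vi uv.
Qed.

Lemma hankel_wreg_col i : wreg (col_ideal (supp_mx K (off part i))) hankel_seq.
Proof.
rewrite /hankel_seq hankel_pairsE; apply: hankel_wreg; first exact: sub0mx.
  rewrite cats0 => j; rewrite size_mkseq => jm.
  have ji : (j < sz i)%N := leq_trans jm (m_min i).
  exists (ptcol K (vx i j)); split; first by apply: supp_ptcol; apply: off_vx.
    move=> l lj; rewrite nth_mkseq ?vx_rows //; last exact: ltn_trans lj jm.
    by rewrite gtn_eqF // raddf0.
  by rewrite nth_mkseq // vx_rows // eqxx scalar1_eq0 oner_eq0.
have [im|im] := eqVneq (sz i) m.
  left; split; first by rewrite -size_eq0 size_mkseq; lia.
  rewrite -sub1mx; apply/row_subP => l; rewrite row1 -[l]enum_valK -/(ptrow K _).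
  move: (enum_val l) => v.
  have [vi|vi] := boolP (off part i v).
    exact: submx_trans (ptrow_sub_supp K vi) (sub_adjrow _ _).
  have {}vi : part v = i by apply/eqP; rewrite /off negbK in vi.
  rewrite -[ptrow K v](subKr (rank_row (rk v))) addmx_sub //.
    by apply: mem_adjrow; apply/mapP; exists (rk v) => //; rewrite mem_iota -im -vi rk_lt.
  rewrite eqmx_opp; exact: submx_trans (rank_row_off vi) (sub_adjrow _ _).
have mi : (m < sz i)%N by rewrite ltn_neqAle eq_sym im m_min.
right; apply: hankel_step => //.
- by apply: last_adjrow; apply: sub0mx.
- apply: (dual_notin (a := ptcol K (vx i m))).
    apply: adjrow_mul0; first by apply: supp_ptcol; apply: off_vx.
    by apply: cs_mul0 => j jm; rewrite vx_rows // gtn_eqF // raddf0.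
  rewrite vx_rows // eqxx orbT andbT (_ : i != i0); last by apply: contraNneq im => ->.
  by rewrite scalar1_eq0 oner_eq0.
by right.
Qed.

Lemma pair_mul (p : 'rV[K]_n * 'rV[K]_n) (a b : 'cV_n) :
  row_mx p.1 p.2 *m col_mx a b = p.1 *m a + p.2 *m b.
Proof. by rewrite mul_row_col. Qed.

(** The matrix with $x = 1$ at rank 1 and $y = -1$ at rank 0 of part [i], and zeros elsewhere: a
    common zero of the Hankel forms and of [off_ideal i]. *)
Definition socle_dual i : 'cV[K]_(n + n) :=
  col_mx (ptcol K (vx i 1)) (- ptcol K (vx i 0)).

Lemma hankel_pair_socle_dual i j : (j <= m)%N ->
  row_mx (hankel_pair j).1 (hankel_pair j).2 *m socle_dual i = 0.
Proof.
move=> jm; rewrite pair_mul mulmxN.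
have [->|jm'] := eqVneq j m.
  rewrite hankel_pair2 ?(ltnW m2) // [X in X *m _](_ : _ = extra_row) /=; last first.
    by rewrite /hankel_pair eqxx.
  have m0 : (0 == m.-1) = false by apply/eqP; lia.
  by rewrite !vx_rows ?sz_gt1 ?sz_gt0 // (ltn_eqF m2) m0 andbF raddf0 subr0.
rewrite /hankel_pair (negPf jm') /=.
case: j jm jm' => [|j] jm jm'.
  by rewrite mul0mx subr0 vx_rows ?sz_gt1 // raddf0.
by rewrite !vx_rows ?sz_gt1 ?sz_gt0 // eqSS subrr.
Qed.

Lemma supp_socle_dual i : dblmx (supp_mx K (off part i)) *m socle_dual i = 0.
Proof.
rewrite /dblmx /socle_dual mul_block_col !mul0mx addr0 add0r mulmxN.
by rewrite !supp_ptcol ?off_vx ?sz_gt0 ?sz_gt1 // oppr0 col_mx0.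
Qed.

(** Modulo linear forms only independence is at stake. The dual vectors are $x$ at rank 0 for the
    first form, $y$ at rank [j] for the Hankel form of index [j.+1], and [socle_dual i] for the last
    form. *)
Lemma theta_wreg_off i : wreg (@off_ideal K _ _ part i) theta.
Proof.
have -> : theta = map (@lform K _)
    (rcons [seq row_mx p.1 p.2 | p <- hankel_pairs] (row_mx last_xrow last_yrow)).
  by rewrite map_rcons -map_comp.
apply: Lin_wreg => j; rewrite size_rcons size_map size_mkseq ltnS => jm.
have nthE (l : nat) : (l <= m)%N ->
    (rcons [seq row_mx p.1 p.2 | p <- hankel_pairs] (row_mx last_xrow last_yrow))`_l =
    row_mx (hankel_pair l).1 (hankel_pair l).2.
  move=> lm; rewrite nth_rcons size_map size_mkseq ltnS lm.
  by rewrite (nth_map 0) ?size_mkseq // nth_mkseq.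
have [->|jm'] := eqVneq j m.+1.
  exists (socle_dual i); split; first exact: supp_socle_dual.
    by move=> l lm; rewrite nthE // hankel_pair_socle_dual.
  rewrite nth_rcons size_map size_mkseq ltnn eqxx (pair_mul (_, _)) mulmxN.
  rewrite !vx_rows ?sz_gt0 ?sz_gt1 // !eqxx !andbT -scalemx1 -[_%:M in X in _ - X]scalemx1.
  rewrite -scalerBl scalemx1 scalar1_eq0; case: (i == i0) => /=.
    by rewrite subr0 oner_eq0.
  by rewrite sub0r oppr_eq0 oner_eq0.
have {jm'}jm : (j <= m)%N by rewrite -ltnS ltn_neqAle jm' jm.
case: j jm => [|j] jm.
  exists (col_mx (ptcol K (vx i 0)) 0); split=> //.
    rewrite /dblmx mul_block_col !mul0mx !mulmx0 !addr0 supp_ptcol ?col_mx0 //.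
    by rewrite off_vx ?sz_gt0.
  rewrite nthE // pair_mul mulmx0 addr0 /hankel_pair /= ltn_eqF; last lia.
  by rewrite vx_rows ?sz_gt0 // scalar1_eq0 oner_eq0.
have ji : (j < sz i)%N := leq_trans jm (m_min i).
exists (col_mx 0 (ptcol K (vx i j))); split.
- rewrite /dblmx mul_block_col !mul0mx !mulmx0 !add0r supp_ptcol ?col_mx0 //.
  exact: off_vx.
- move=> l lj; rewrite nthE; last by apply: leq_trans (ltnW lj) _.
  rewrite pair_mul mulmx0 add0r /hankel_pair /=; case: l lj => [|l] lj.
    by rewrite mul0mx.
  by rewrite vx_rows // gtn_eqF // raddf0.
rewrite nthE // pair_mul mulmx0 add0r /= vx_rows // eqxx.
by rewrite scalar1_eq0 oner_eq0.
Qed.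

(** Restriction to the line through the origin with direction [D]. *)
Definition line_poly (D : 'cV[K]_(n + n)) : S -> {poly K} :=
  mmap polyC (fun l : 'I_(n + n) => D l 0 *: 'X).
HB.instance Definition _ D := GRing.RMorphism.copy (line_poly D)
  (mmap polyC (fun l : 'I_(n + n) => D l 0 *: 'X)).

Lemma line_polyX D (l : 'I_(n + n)) : line_poly D 'X_l = D l 0 *: 'X.
Proof. by rewrite /line_poly mmapX mmap1U. Qed.

Lemma line_poly_lform D (w : 'rV_(n + n)) : line_poly D (lform w) = (w *m D) 0 0 *: 'X.
Proof.
rewrite /lform rmorph_sum mxE scaler_suml; apply: eq_bigr => l _.
by rewrite -mul_mpolyC rmorphM /= line_polyX /line_poly mmapC mul_polyC scalerA.
Qed.

Lemma idealp_line_poly D :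
  idealp (fun f => (line_poly D f)`_0 = 0 /\ (line_poly D f)`_1 = 0).
Proof.
split.
- by rewrite rmorph0 !coef0.
- by move=> f g [f0 f1] [g0 g1]; rewrite rmorphD !coefD f0 f1 g0 g1 addr0.
- move=> f g [g0 g1]; rewrite rmorphM !coefM !big_ord_recl !big_ord0 /=.
  by rewrite g0 g1 !mulr0 !addr0.
Qed.

Local Notation v1 := (vx i0 1).
Local Notation soc := (adjs (col_ideal (supp_mx K (off part i0))) hankel_seq).

(** On the line spanned by [socle_dual i0] all generators vanish to second order, the linear ones
    identically and the minors because they are quadratic, whereas this variable restricts to the
    parameter itself. *)
Lemma socle_notin : ~ soc (xvar K v1).
Proof.
pose D := socle_dual i0; have iD := idealp_line_poly D.
suff sub f : soc f -> (line_poly D f)`_0 = 0 /\ (line_poly D f)`_1 = 0.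
  case/sub => _; rewrite xvarE line_poly_lform mul_row_col mul0mx addr0.
  rewrite ptrowE rowfn_ptcol eqxx !mxE /= mulr1n scale1r coefX => /eqP.
  by rewrite oner_eq0.
apply: (adjs_sub iD) => {}f.
  apply: (isum_sub iD) => {}f.
    move=> /det_minors; apply: (gideal_sub iD) => _ [u [w ->]].
    rewrite rmorphB !rmorphM /= !line_polyX -!scalerAl -!scalerAr.
    by rewrite !(coefB, coefZ, coefXM, coefX) /= !mulr0 subr0.
  apply: (Lin_sub iD) => w /submxP[c ->]; rewrite line_poly_lform -mulmxA.
  by rewrite supp_socle_dual mulmx0 mxE scale0r !coef0.
move=> /mapP[p /mapP[j + ->] ->]; rewrite mem_iota /= ltnS => jm.
by rewrite line_poly_lform hankel_pair_socle_dual // mxE scale0r !coef0.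
Qed.

(** With $x_j$, $y_j$ the variables at [vx i0 j], the forms impose $x_0 = 0$, $x_{j+1} = -y_j$ and
    $y_{m-1} = 0$. A minor gives $x_j y_0 = x_0 y_j = 0$, so $x_j x_1 = -x_j y_0 = 0$ and $y_j x_1 =
    -x_{j+1} x_1 = 0$. *)
Lemma socle_mul (z : 'I_(n + n)) : soc ('X_z * xvar K v1).
Proof.
have iE := idealp_col (supp_mx K (off part i0)); have iS := idealp_adjs hankel_seq iE.
have colS f : col_ideal (supp_mx K (off part i0)) f -> soc f by apply: sub_adjs.
have hS j : (j <= m)%N -> soc (pform (hankel_pair j)).
  move=> jm; apply: mem_adjs => //; apply/mapP; exists (hankel_pair j) => //.
  by apply/mapP; exists j; rewrite ?mem_iota.
pose x j := xvar K (vx i0 j); pose y j := yvar K (vx i0 j).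
have rowS (a b c d : 'rV[K]_n) : (a - c <= supp_mx K (off part i0))%MS ->
    (b - d <= supp_mx K (off part i0))%MS ->
    soc (lform (row_mx a b)) -> soc (lform (row_mx c d)).
  move=> ac bd ab; rewrite -[row_mx c d](subKr (row_mx a b)) linearB.
  apply: (idealB iS) => //; apply: colS; apply: mem_colE.
  by rewrite opp_row_mx add_row_mx sub_block_diag ac.
have rkv j : (j < m)%N ->
    (rank_row j - ptrow K (vx i0 j) <= supp_mx K (off part i0))%MS.
  by move=> jm; rewrite -{1}(rk_vx jm); apply: rank_row_off; apply: part_vx.
have x0S : soc (x 0%N).
  rewrite /x xvarE; apply: rowS (hS 0%N _) => //; rewrite /hankel_pair /= ?subrr ?sub0mx //.
  by rewrite ltn_eqF ?rkv // ?(ltnW m2).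
have xyS j : (j.+1 < m)%N -> soc (x j.+1 + y j).
  move=> jm; rewrite /x /y xvarE yvarE -linearD add_row_mx addr0 add0r.
  apply: rowS (hS j.+1 _); rewrite ?(ltnW jm) // /hankel_pair /=.
    by rewrite ltn_eqF ?rkv.
  by rewrite rkv // ltnW.
have ylS : soc (y m.-1).
  rewrite /y yvarE; apply: rowS (hS m _) => //.
    rewrite /hankel_pair eqxx subr0; apply: rowfn_sub_supp => u.
    by rewrite /off negbK => /eqP ->; rewrite eqxx.
  by rewrite hankel_pair2 ?(ltnW m2) // rkv; lia.
have xxS j : (j < m)%N -> soc (x j * x 1%N).
  move=> jm; have xy1 := xyS 0%N m2.
  have m1 : soc (edge_binomial K (vx i0 0) (vx i0 j)).
    by apply: colS; apply: det_col; apply: edge_binomial_det.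
  rewrite (_ : x j * x 1%N = x j * (x 1%N + y 0%N) +
    edge_binomial K (vx i0 0) (vx i0 j) - y j * x 0%N); last first.
    by rewrite /x /y /edge_binomial; ring.
  by apply: (idealB iS); [apply: (idealD iS) => // | ]; apply: (idealM iS).
have yxS j : (j < m)%N -> soc (y j * x 1%N).
  move=> jm; have [jm'|jm'] := ltnP j.+1 m.
    rewrite (_ : y j * x 1%N = x 1%N * (x j.+1 + y j) - x j.+1 * x 1%N); last by ring.
    by apply: (idealB iS); [apply: (idealM iS); apply: xyS | apply: xxS].
  have -> : j = m.-1 by lia.
  by rewrite mulrC; apply: (idealM iS).
have inS v (f : S) : f = xvar K v \/ f = yvar K v -> soc (f * x 1%N).
  have [vo|vo] := boolP (off part i0 v).
    case=> ->; rewrite mulrC; apply: (idealM iS); apply: colS; apply: Lin_col.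
      exact: mem_Lin_supp_x.
    exact: mem_Lin_supp_y.
  have vi : part v = i0 by apply/eqP; rewrite /off negbK in vo.
  have rv : (rk v < m)%N by rewrite -vi rk_lt.
  have vE : v = vx i0 (rk v) by rewrite -vi vxK.
  by case=> ->; rewrite vE; [apply: xxS | apply: yxS].
rewrite -(splitK z); case: (split z) => u /=.
  apply: (inS (enum_val u)); left; by rewrite /xvar enum_valK.
apply: (inS (enum_val u)); right; by rewrite /yvar enum_valK.
Qed.

Definition variables : seq S := [seq 'X_z | z <- enum 'I_(n + n)].

Lemma lform_variables (w : 'rV_(n + n)) : gideal (fun f => f \in variables) (lform w).
Proof.
have iG := idealp_gideal (fun f => f \in variables).
apply: (ideal_sum _ iG) => l _; rewrite -mul_mpolyC; apply: (idealM iG).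
by apply: mem_gideal; apply/mapP; exists l; rewrite ?mem_enum.
Qed.

Lemma theta_variables f : f \in theta -> gideal (fun f => f \in variables) f.
Proof.
rewrite mem_rcons inE => /predU1P[->|/mapP[p _ ->]]; exact: lform_variables.
Qed.

Lemma hankel_seq_theta f : f \in hankel_seq -> f \in theta.
Proof. by rewrite mem_rcons inE orbC => ->. Qed.

Lemma theta_wreg_edge T : wreg (edge_ideal (mp_rel part T)) theta.
Proof.
apply: wreg_edge; [exact: theta_wreg_off | exact: hankel_wreg_col |].
exact: theta_wreg_det.
Qed.

(** Length $m+3$ would give $H^{m+2} = 0$ for the intersection. Since [theta] gives $H^{m+1} = 0$
    for both outer quotients, $H^{m+1}$ would vanish for the sum of the two ideals, and the $m+1$
    Hankel forms would carry this down to $H^0$, which holds the socle element. *)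
Lemma wreg_size_le s : (forall f, f \in s -> gideal (fun f => f \in variables) f) ->
  wreg (edge_ideal (mp_rel part [set: I])) s -> (size s <= m.+2)%N.
Proof.
move=> sV ws; rewrite leqNgt; apply/negP => sm.
have i0T : i0 \notin [set: I] :\ i0 by rewrite setD11.
have iE := idealp_edge K (mp_rel part [set: I]).
have iE' := idealp_edge K (mp_rel part ([set: I] :\ i0)).
have iO := @idealp_off K _ _ part i0.
have iC := idealp_col (supp_mx K (off part i0)).
have st : size theta = m.+2 by rewrite size_rcons size_hankel_seq.
have vJ : koszul_vanish variables (icap (edge_ideal (mp_rel part ([set: I] :\ i0)))
    (@off_ideal K _ _ part i0)) m.+2.
  by rewrite -edge_ideal_setU1 // setD1K ?inE //; apply: wreg_koszul_vanish ws _ _.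
have vC : koszul_vanish variables (col_ideal (supp_mx K (off part i0))) m.+1.
  rewrite -(@isum_edge_off _ _ _ _ _ _ i0T); apply: koszul_vanish_isum => //.
    by apply: wreg_koszul_vanish theta_variables (theta_wreg_edge _) _ _; rewrite ?st.
  by apply: wreg_koszul_vanish theta_variables (theta_wreg_off _) _ _; rewrite ?st.
apply: socle_notin; apply: (koszul_vanish_socle (zs := variables)).
- exact: idealp_adjs.
- apply: koszul_vanish_adjs; rewrite ?size_hankel_seq //; last exact: hankel_wreg_col.
  by move=> f /hankel_seq_theta; apply: theta_variables.
- by move=> _ /mapP[z _ ->]; apply: socle_mul.
Qed.

End HankelSequence.

(** * The depth of the quotient module *)

Section RegularSequences.
Variables (R : comNzRingType) (J : submodule R^o).
Local Notation M := (quot_mod J).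
Local Notation piJ := (\pi_(Quotient.quot (submod_pred J))).

Definition sub_ideal : R -> Prop := fun f => (f : R^o) \in J.

Lemma idealp_sub : idealp sub_ideal.
Proof.
split; first exact: rpred0.
- by move=> f g; apply: rpredD.
- by move=> a f; apply: (rpredZ a).
Qed.

Lemma adjsP (I : R -> Prop) s f :
  adjs I s f <-> exists g : nat -> R, I (f - \sum_(i < size s) g i * s`_i).
Proof.
elim: s I => [|x s IHs] I /=.
  split=> [If|[g]]; last by rewrite big_ord0 subr0.
  by exists (fun=> 0); rewrite big_ord0 subr0.
rewrite IHs; split=> [[g [a Ia]]|[g Ig]].
  exists (fun i => if i is i'.+1 then g i' else a); rewrite big_ord_recl /=.
  by rewrite opprD addrA (addrAC f).
exists (fun i => g i.+1), (g 0%N); move: Ig; rewrite big_ord_recl /=.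
by rewrite opprD addrA (addrAC f).
Qed.

Definition qpi (f : R) : M := piJ (f : R^o).

Lemma qpiD f g : qpi (f + g) = qpi f + qpi g.
Proof. exact: (raddfD piJ). Qed.

Lemma qpi0 : qpi 0 = 0.
Proof. exact: (raddf0 piJ). Qed.

Lemma qpiZ a f : qpi (a * f) = a *: qpi f.
Proof. by rewrite [RHS](quot_scale_pi J a (f : R^o)). Qed.

Lemma qpi_surj x : exists f, x = qpi f.
Proof.
exists (repr (x : Quotient.quot (submod_pred J))).
by rewrite /qpi reprK.
Qed.

Lemma qpi_eq f g : qpi f = qpi g <-> sub_ideal (f - g).
Proof.
rewrite /sub_ideal (Quotient.idealrBE (submod_pred J) (f : R^o) (g : R^o)).
by split=> [fg|/eqP //]; apply/eqP.
Qed.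

Lemma qpi_sum N (g h : nat -> R) :
  qpi (\sum_(i < N) g i * h i) = \sum_(i < N) h i *: qpi (g i).
Proof.
rewrite (big_morph qpi qpiD qpi0); apply: eq_bigr => i _.
by rewrite mulrC qpiZ.
Qed.

Lemma in_seq_mulP s f : in_seq_mul s (qpi f) <-> adjs sub_ideal s f.
Proof.
rewrite adjsP; split=> [[h fE]|[g /qpi_eq fE]]; last first.
  by exists (fun i => qpi (g i)); rewrite fE (qpi_sum _ _ (nth 0 s)).
have [g gE] : {g : nat -> R & forall i : 'I_(size s), h i = qpi (g i)}.
  have [g gE] := boolp.choice (fun i => qpi_surj (h i)).
  exists (fun i => if insub i is Some j then g j else 0) => i.
  by rewrite valK.
exists g; apply/qpi_eq; rewrite fE (qpi_sum _ _ (nth 0 s)).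
by apply: eq_bigr => i _; rewrite gE.
Qed.

(** The module is generated by the class of 1, so its quotient by [s] is nonzero exactly when 1
    stays outside of the ideal. *)
Lemma regular_seqP s :
  regular_seq M s <-> wreg sub_ideal s /\ ~ adjs sub_ideal s 1.
Proof.
split=> [[rs [x xs]]|[/wregP rs s1]]; split.
- apply/wregP => i si f; rewrite -!in_seq_mulP qpiZ; exact: rs.
- move=> s1; apply: xs; have [f ->] := qpi_surj x; apply/in_seq_mulP.
  by rewrite -[f]mulr1; apply: idealM s1; apply: idealp_adjs; apply: idealp_sub.
- move=> i si x; have [f ->] := qpi_surj x; rewrite -qpiZ !in_seq_mulP; exact: rs.
- by exists (qpi 1); rewrite in_seq_mulP.
Qed.

End RegularSequences.

Section GeneratedIdeals.
Variables (K : fieldType) (V : finType).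

Lemma ideal_genE (R : comNzRingType) (E : R -> Prop) :
  sub_ideal (ideal_gen E) = gideal E.
Proof.
have iE := idealp_gideal E.
apply: pred_eqP => f; split.
  move=> /asboolP[s [sE ->]]; rewrite big_seq; apply: ideal_sum => // p ps.
  by apply: (idealM iE); apply: mem_gideal; apply: sE.
apply: gideal_sub; first exact: idealp_sub.
move=> g Eg; apply/asboolP; exists [:: (1, g)]; split.
  by move=> p; rewrite inE => /eqP->.
by rewrite big_seq1 mul1r.
Qed.

Lemma graded_max_ideal_variables :
  sub_ideal (graded_max_ideal K V) = gideal (fun f => f \in variables K V).
Proof.
rewrite ideal_genE; apply: pred_eqP => f; split; apply: gideal_sub; try exact: idealp_gideal.
  move=> _ [u [->|->]]; apply: mem_gideal; apply/mapP.
    by exists (lshift #|V| (enum_rank u)); rewrite ?mem_enum.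
  by exists (rshift #|V| (enum_rank u)); rewrite ?mem_enum.
move=> _ /mapP[z _ ->]; apply: mem_gideal; rewrite -(splitK z).
case: (split z) => i /=; exists (enum_val i).
  by left; rewrite /xvar enum_valK.
by right; rewrite /yvar enum_valK.
Qed.

Lemma variables_mcoeff0 f : gideal (fun f => f \in variables K V) f -> f@_0%MM = 0.
Proof.
apply: (gideal_sub (idealp_ker (mcoeff 0%MM))) => _ /mapP[z _ ->].
by rewrite /= mcoeffX mnm1_eq0.
Qed.

End GeneratedIdeals.

Theorem corollary4p5 (K : fieldType) (k : nat) (hk : (2 <= k)%N)
    (n : 'I_k -> nat) (V : finType) (e : rel V)
    (hn1 : (2 <= n (Ordinal (ltnW hk)))%N)
    (hmono : forall i j : 'I_k, (i <= j)%N -> (n i <= n j)%N)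
    (hG : complete_multipartite n e) :
  has_depth (quot_mod (binomial_edge_ideal K e)) (graded_max_ideal K V)
    (n (Ordinal (ltnW hk)) + 2)%N.
Proof.
have [part [card_part eE]] := hG.
set i0 := Ordinal (ltnW hk) in hn1 *; pose i1 := Ordinal hk.
have i10 : i1 != i0 by [].
have m_min i : (n i0 <= n i)%N by apply: hmono.
pose fiber i := enum [set v | part v == i].
have fiber_size i : size (fiber i) = n i by rewrite -cardE.
have mem_fiber i v : (v \in fiber i) = (part v == i) by rewrite mem_enum inE.
have [v0 _] : exists v0 : V, true.
  case E : (fiber i0) (fiber_size i0) => [|v ?]; last by exists v.
  by move=> n0; rewrite -n0 in hn1.
pose rk v := index v (fiber (part v)).
pose vx i j := nth v0 (fiber i) j.
have rk_lt v : (rk v < n (part v))%N by rewrite -fiber_size index_mem mem_fiber.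
have vxK v : vx (part v) (rk v) = v by rewrite /vx nth_index // mem_fiber.
have part_vx i j : (j < n i)%N -> part (vx i j) = i.
  by move=> ji; apply/eqP; rewrite -mem_fiber mem_nth // fiber_size.
have rk_vx i j : (j < n i)%N -> rk (vx i j) = j.
  by move=> ji; rewrite /rk part_vx // index_uniq ?enum_uniq // fiber_size.
have JE : sub_ideal (binomial_edge_ideal K e) = edge_ideal (mp_rel part [set: 'I_k]).
  rewrite ideal_genE /edge_ideal; congr gideal; apply: funext => f; apply: propext.
  have ee u w : mp_rel part [set: 'I_k] u w = e u w by rewrite /mp_rel inE orbF eE.
  by split=> -[u [w [uw ->]]]; exists u, w; split=> //; move: uw; rewrite ee.
have mE := graded_max_ideal_variables K V.
pose th := theta K part i0 n rk.
have thV := @theta_variables K V _ part i0 n rk.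
split.
  exists th; split.
  - by move=> f /thV; rewrite -mE.
  - apply/regular_seqP; rewrite JE; split.
      exact: (theta_wreg_edge K i10 rk_lt vxK part_vx rk_vx hn1 m_min).
    (* All generators have constant term zero, and 1 has not. *)
    move=> th1; have /eqP := oner_neq0 K; apply.
    rewrite -(rmorph1 (mcoeff (0%MM : 'X_{1..#|V| + #|V|}))).
    have iC := idealp_ker (mcoeff (0%MM : 'X_{1..#|V| + #|V|}) : {rmorphism _ -> K}).
    apply: (adjs_sub iC) th1 => [|f /thV/variables_mcoeff0 //].
    apply: (edge_ideal_sub iC) => u w _ /=.
    by rewrite rmorphB !rmorphM /= !mcoeffX !mnm1_eq0 !mul0r subr0.
  - by rewrite size_rcons size_hankel_seq addn2.
move=> s sm /regular_seqP[]; rewrite JE addn2 => ws _.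
apply: (wreg_size_le i10 rk_lt vxK part_vx rk_vx hn1 m_min) ws.
by move=> f fs; rewrite -mE; apply: sm.
Qed.
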